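(* Let $q>0$, let $((\bar c,\bar b),\bar x)\in\mathrm{gph}\,\mathcal S$, and suppose that $P(\bar c,\bar b)$ satisfies the Slater condition. Consider the following assertions: (i) $\mathcal S$ possesses the $q$-order isolated calmness property at $((\bar c,\bar b),\bar x)$; (ii) $\mathcal S_{\bar c}$ possesses the $q$-order isolated calmness property at $(\bar b,\bar x)$; (iii) $\mathcal L$ possesses the $q$-order isolated calmness property at $((\langle\bar c,\bar x\rangle,\bar b),\bar x)$; (iv) $\bar x$ is a $q$-order sharp minimizer of $f$; (v) $\|f'_q(\bar x;\cdot)\|_q>0$; (vi) $\|D_{\frac1q}\mathcal S_{\bar c}(\bar b,\bar x)\|^+_{\frac1q}<+\infty$. Then (i) $\Leftrightarrow$ (ii) $\Leftrightarrow$ (iii) $\Leftrightarrow$ (iv) $\Leftrightarrow$ (v) $\Rightarrow$ (vi). If $T$ is finite, then all the assertions are equivalent, and $$\mathrm{clm}_q\,\mathcal S_{\bar c}(\bar b,\bar x)=\left(\left\|D_{\frac1q}\mathcal S_{\bar c}(\bar b,\bar x)\right\|^+_{\frac1q}\right)^{-q}.$$ If $q>1$, then assertions (i)--(v) are equivalent to the next one: (vii) $D_{q-1}\partial f(\bar x,0)$ is $(q-1)$-order positively definite.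
   Context: Setting. $T$ is a compact Hausdorff space, $t\mapsto a_t\in\mathbb R^n$ is continuous on $T$, $\langle\cdot,\cdot\rangle$ is the usual inner product and $\|\cdot\|$ the Euclidean norm in $\mathbb R^n$; $C(T,\mathbb R)$ has the norm $\|b\|_\infty=\max_{t\in T}|b_t|$, and $\mathbb R^n\times C(T,\mathbb R)$ has the norm $\|(c,b)\|=\max\{\|c\|,\|b\|_\infty\}$ (similarly $\mathbb R\times C(T,\mathbb R)$ has the maximum norm). For $(c,b)\in\mathbb R^n\times C(T,\mathbb R)$, $P(c,b)$ is the linear semi-infinite problem: minimize $\langle c,x\rangle$ over $x\in\mathbb R^n$ subject to $\langle a_t,x\rangle\le b_t$, $t\in T$. Mappings: $\mathcal F(b):=\{x\in\mathbb R^n:\langle a_t,x\rangle\le b_t,\ t\in T\}$; $\mathcal S(c,b):=\{x\in\mathcal F(b): x\text{ solves }P(c,b)\}$; $\mathcal S_{\bar c}(b):=\mathcal S(\bar c,b)$, $b\in C(T,\mathbb R)$; $\mathcal L(\alpha,b):=\{x\in\mathcal F(b):\langle\bar c,x\rangle\le\alpha\}$, $(\alpha,b)\in\mathbb R\times C(T,\mathbb R)$. Function: $f(x):=\max\{\langle\bar c,x-\bar x\rangle,\ \max_{t\in T}(\langle a_t,x\rangle-\bar b_t)\}$, $x\in\mathbb R^n$ (convex and continuous), and $\partial f:\mathbb R^n\rightrightarrows\mathbb R^n$ is its convex subdifferential. $P(c,b)$ satisfies the Slater condition if there is $\hat x\in\mathbb R^n$ with $\langle a_t,\hat x\rangle<b_t$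 for all $t\in T$. Definitions. For a set-valued mapping $F:U\rightrightarrows W$, $\mathrm{gph}\,F=\{(u,w):w\in F(u)\}$. A mapping $S:Y\rightrightarrows X$ between normed spaces has the $q$-order isolated calmness property at $(\bar y,\bar x)\in\mathrm{gph}\,S$ with modulus $\tau>0$ if there are neighbourhoods $U$ of $\bar x$, $V$ of $\bar y$ with $\tau\|x-\bar x\|^q\le\|y-\bar y\|$ for all $y\in V$, $x\in S(y)\cap U$; it has the property if this holds for some $\tau>0$; $\mathrm{clm}_qS(\bar y,\bar x)$ is the supremum of such $\tau$ ($0$ if none). $\bar x$ is a $q$-order sharp minimizer of $f$ if there are $\tau>0$ and a neighbourhood $U$ of $\bar x$ with $\tau\|x-\bar x\|^q\le f(x)-f(\bar x)$ for all $x\in U$. $f'_q(\bar x;x):=\liminf_{u\to x,\,t\downarrow0}\frac{f(\bar x+tu)-f(\bar x)}{t^q}$, and $\|f'_q(\bar x;\cdot)\|_q:=\inf_{\|x\|=1}\max\{0,f'_q(\bar x;x)\}$. For $r>0$ and $F:U\rightrightarrows W$, the $r$-order graphical derivative $D_rF(\bar u,\bar w):U\rightrightarrows W$ at $(\bar u,\bar w)\in\mathrm{gph}\,F$: $w\in D_rF(\bar u,\bar w)(u)$ iff there exist $(u_k,w_k)\to(u,w)$, $t_k\downarrow0$ with $(\bar u+t_ku_k,\bar w+t_k^rw_k)\in\mathrm{gph}\,F$ for all $k\in\mathbb N$. For $H:U\rightrightarrows W$ with $0\in H(0)$ and $H(\lambda u)=\lambda^rH(u)$ for all $u$ and $\lambda>0$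 (as holds for $H=D_rF(\bar u,\bar w)$): $\|H\|^+_r:=\sup_{(u,w)\in\mathrm{gph}\,H\setminus\{(0,0)\}}\|w\|/\|u\|^r$, with $a/0=+\infty$ for $a>0$, $\sup\emptyset=0$. Conventions: $0^{-q}=+\infty$, $(+\infty)^{-q}=0$. For $r>0$, $H:\mathbb R^n\rightrightarrows\mathbb R^n$ is $r$-order positively definite if there is $\lambda>0$ with $\langle x^*,x\rangle\ge\lambda\|x\|^{r+1}$ for all $(x,x^* )\in\mathrm{gph}\,H$. *)

(* Defs.v *)
From HB Require Import structures.
From mathcomp Require Import all_boot all_order all_algebra.
From mathcomp Require Import all_classical all_reals all_analysis.
From mathcomp Require Import ring.

Set Implicit Arguments.
Unset Strict Implicit.
Unset Printing Implicit Defensive.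

Import Order.TTheory GRing.Theory Num.Theory.
Import numFieldNormedType.Exports.

Local Open Scope classical_set_scope.
Local Open Scope ring_scope.

(* The library norm on 'rV[R]_n is the maximum norm; [euclid R n] is a copy of
   'rV[R]_n carrying the Euclidean norm instead. *)
Definition euclid (R : realType) (n : nat) : Type := 'rV[R]_n.

HB.instance Definition _ (R : realType) (n : nat) :=
  GRing.Lmodule.copy (euclid R n) 'rV[R]_n.

Definition dot (R : realType) (n : nat) (x y : euclid R n) : R :=
  \sum_(i < n) (x : 'rV[R]_n) 0 i * (y : 'rV[R]_n) 0 i.

Section EuclideanNorm.
Context (R : realType) (n : nat).
Implicit Types x y z : euclid R n.

Lemma dotC x y : dot x y = dot y x.
Proof. by apply: eq_bigr => i _; rewrite mulrC. Qed.

Lemma dotDl x y z : dot (x + y) z = dot x z + dot y z.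
Proof. by rewrite -big_split; apply: eq_bigr => i _; rewrite mxE mulrDl. Qed.

Lemma dotZl (k : R) x y : dot (k *: x) y = k * dot x y.
Proof. by rewrite mulr_sumr; apply: eq_bigr => i _; rewrite mxE mulrA. Qed.

Lemma dotDr x y z : dot x (y + z) = dot x y + dot x z.
Proof. by rewrite dotC dotDl !(dotC x). Qed.

Lemma dotZr (k : R) x y : dot x (k *: y) = k * dot x y.
Proof. by rewrite dotC dotZl (dotC x). Qed.

Lemma dot_ge0 x : 0 <= dot x x.
Proof. by apply: sumr_ge0 => i _; rewrite -expr2 sqr_ge0. Qed.

Lemma dot_eq0 x : dot x x = 0 -> x = 0.
Proof.
move=> /psumr_eq0P x0; apply/rowP => i; rewrite mxE; apply/eqP.
rewrite -sqrf_eq0 expr2 x0// => j _; by rewrite -expr2 sqr_ge0.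
Qed.

Lemma dot_CauchySchwarz x y : dot x y ^+ 2 <= dot x x * dot y y.
Proof.
have [y0|y0] := eqVneq (dot y y) 0.
  have -> : y = 0 *: y by rewrite (dot_eq0 y0) scaler0.
  by rewrite !dotZr !mul0r mulr0 expr2 mul0r.
have yy : 0 < dot y y by rewrite lt_def y0 dot_ge0.
have := dot_ge0 (dot y y *: x + (- dot x y) *: y).
suff -> : dot (dot y y *: x + (- dot x y) *: y) (dot y y *: x + (- dot x y) *: y)
          = dot y y * (dot x x * dot y y - dot x y ^+ 2).
  by rewrite pmulr_rge0// subr_ge0.
by rewrite !(dotDl, dotDr, dotZl, dotZr) (dotC y x); ring.
Qed.

Definition enorm x : R := Num.sqrt (dot x x).

Lemma ler_enormD x y : enorm (x + y) <= enorm x + enorm y.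
Proof.
rewrite -(@ler_pXn2r _ 2)// ?nnegrE ?addr_ge0 ?sqrtr_ge0//.
rewrite sqrrD !sqr_sqrtr ?dot_ge0// !(dotDl, dotDr) (dotC y x).
rewrite addrA lerD2r -addrA lerD2l -mulr2n lerMn2r/=.
rewrite (le_trans (ler_norm _))// -sqrtr_sqr -sqrtrM ?dot_ge0//.
by rewrite ler_wsqrtr// dot_CauchySchwarz.
Qed.

Lemma enormZ (k : R) x : enorm (k *: x) = `|k| * enorm x.
Proof.
by rewrite /enorm dotZl dotZr mulrA -expr2 sqrtrM ?sqr_ge0// sqrtr_sqr.
Qed.

Lemma enorm_eq0 x : enorm x = 0 -> x = 0.
Proof.
move=> /eqP; rewrite sqrtr_eq0 => x0.
by apply: dot_eq0; apply/eqP; rewrite eq_le x0 dot_ge0.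
Qed.

HB.instance Definition _ :=
  @Lmodule_isNormed.Build R (euclid R n) enorm ler_enormD enormZ enorm_eq0.

End EuclideanNorm.

(* C(T, R) with the maximum norm. Compactness of T is a parameter of the type
   because the norm axioms depend on it. *)
Definition ctsfun (R : realType) (T : topologicalType)
  (cT : compact [set: T]) : Type := continuousType T R.

Section ContinuousFunctions.
Context (R : realType) (T : topologicalType) (cT : compact [set: T]).
Local Notation C := (@ctsfun R T cT).

Definition ctsfun_fun (b : C) : T -> R := fun t => Continuous.sort b t.
Local Coercion ctsfun_fun : ctsfun >-> Funclass.

HB.instance Definition _ := Choice.copy C (continuousType T R).

Implicit Types b d : C.

Lemma ctsfunP b d : b =1 d -> b = d.
Proof. by move=> bd; apply/continuousEP. Qed.

Lemma ctsfun_continuous b : continuous (b : T -> R).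
Proof. exact: cts_fun. Qed.

Fact ctsfun_add_subproof b d : continuous (fun t => b t + d t).
Proof. by move=> t; apply: cvgD; exact: ctsfun_continuous. Qed.
Definition ctsfun_add b d : C := (mkcts (@ctsfun_add_subproof b d) : continuousType T R).

Fact ctsfun_opp_subproof b : continuous (fun t => - b t).
Proof. by move=> t; apply: cvgN; exact: ctsfun_continuous. Qed.
Definition ctsfun_opp b : C := (mkcts (@ctsfun_opp_subproof b) : continuousType T R).

Fact ctsfun_scale_subproof (k : R) b : continuous (fun t => k * b t).
Proof. by move=> t; apply: cvgM; [exact: cvg_cst|exact: ctsfun_continuous]. Qed.
Definition ctsfun_scale (k : R) b : C := (mkcts (@ctsfun_scale_subproof k b) : continuousType T R).

Fact ctsfun_zero_subproof : continuous (fun _ : T => 0 : R).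
Proof. by move=> t; exact: cvg_cst. Qed.
Definition ctsfun_zero : C := (mkcts ctsfun_zero_subproof : continuousType T R).

Fact ctsfun_addA : associative ctsfun_add.
Proof. by move=> b d e; apply: ctsfunP => t; exact: addrA. Qed.
Fact ctsfun_addC : commutative ctsfun_add.
Proof. by move=> b d; apply: ctsfunP => t; exact: addrC. Qed.
Fact ctsfun_add0 : left_id ctsfun_zero ctsfun_add.
Proof. by move=> b; apply: ctsfunP => t; exact: add0r. Qed.
Fact ctsfun_addN : left_inverse ctsfun_zero ctsfun_opp ctsfun_add.
Proof. by move=> b; apply: ctsfunP => t; exact: addNr. Qed.

HB.instance Definition _ := GRing.isZmodule.Build C
  ctsfun_addA ctsfun_addC ctsfun_add0 ctsfun_addN.

Fact ctsfun_scaleA (k l : R) b :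
  ctsfun_scale k (ctsfun_scale l b) = ctsfun_scale (k * l) b.
Proof. by apply: ctsfunP => t; exact: mulrA. Qed.
Fact ctsfun_scale1 : left_id 1 ctsfun_scale.
Proof. by move=> b; apply: ctsfunP => t; exact: mul1r. Qed.
Fact ctsfun_scaleDr : right_distributive ctsfun_scale +%R.
Proof. by move=> k b d; apply: ctsfunP => t; exact: mulrDr. Qed.
Fact ctsfun_scaleDl b : {morph ctsfun_scale^~ b : k l / k + l}.
Proof. by move=> k l; apply: ctsfunP => t; exact: mulrDl. Qed.

HB.instance Definition _ := GRing.Zmodule_isLmodule.Build R C
  ctsfun_scaleA ctsfun_scale1 ctsfun_scaleDr ctsfun_scaleDl.

Definition supnorm b : R := sup [set `|b t| | t in [set: T]].

Lemma has_sup_supnorm b (t : T) : has_sup [set `|b t| | t in [set: T]].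
Proof.
apply: compact_has_sup; first by exists `|b t|, t.
apply: (@continuous_compact T R (fun t => `|b t|)) => //.
apply: continuous_subspaceT => s.
by apply: cvg_norm; exact: ctsfun_continuous.
Qed.

Lemma supnorm_ub b t : `|b t| <= supnorm b.
Proof. by apply: sup_upper_bound; [exact: has_sup_supnorm|exists t]. Qed.

Lemma supnorm_ge0 b : 0 <= supnorm b.
Proof.
have [[t ?]|T0] := pselect ([set: T] !=set0).
  exact: le_trans (normr_ge0 _) (supnorm_ub b t).
rewrite /supnorm (_ : [set _ | _ in _] = set0) ?sup0//.
by apply/seteqP; split => // y [t _ _]; apply: T0; exists t.
Qed.

Lemma supnorm_le b (M : R) : 0 <= M -> (forall t, `|b t| <= M) -> supnorm b <= M.
Proof.
move=> M0 bM; have [[t ?]|T0] := pselect ([set: T] !=set0).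
  by apply: ge_sup => [|_ [s _ <-]]; [exists `|b t|, t|exact: bM].
rewrite /supnorm (_ : [set _ | _ in _] = set0) ?sup0//.
by apply/seteqP; split => // y [t _ _]; apply: T0; exists t.
Qed.

Lemma ler_supnormD b d : supnorm (b + d) <= supnorm b + supnorm d.
Proof.
apply: supnorm_le => [|t]; first by rewrite addr_ge0 ?supnorm_ge0.
by apply: le_trans (ler_normD _ _) _; rewrite lerD ?supnorm_ub.
Qed.

Lemma supnormZ_le (k : R) b : supnorm (k *: b) <= `|k| * supnorm b.
Proof.
apply: supnorm_le => [|t]; first by rewrite mulr_ge0 ?supnorm_ge0.
by rewrite -[leLHS]/(`|k * b t|) normrM ler_wpM2l ?supnorm_ub.
Qed.

Lemma supnormZ (k : R) b : supnorm (k *: b) = `|k| * supnorm b.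
Proof.
apply/eqP; rewrite eq_le supnormZ_le/=.
have [->|k0] := eqVneq k 0; first by rewrite normr0 mul0r supnorm_ge0.
rewrite -ler_pdivlMl ?normr_gt0// -normfV -{1}[b]scale1r -(mulVf k0) -scalerA.
exact: supnormZ_le.
Qed.

Lemma supnorm_eq0 b : supnorm b = 0 -> b = 0.
Proof.
move=> b0; apply: ctsfunP => t; apply/eqP.
by rewrite -normr_le0 -b0 supnorm_ub.
Qed.

HB.instance Definition _ :=
  @Lmodule_isNormed.Build R C supnorm ler_supnormD supnormZ supnorm_eq0.

End ContinuousFunctions.

Coercion ctsfun_fun : ctsfun >-> Funclass.

Section LocalNotions.
Context (R : realType).

Section GrowthNotions.
Context (X Y : normedModType R).

Definition isolated_calm_with (q tau : R) (S : Y -> set X) (y0 : Y)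
    (x0 : X) : Prop :=
  0 < tau /\
  exists U : set X, exists V : set Y, [/\ nbhs x0 U, nbhs y0 V &
    forall y x, V y -> S y x -> U x ->
      tau * `|x - x0| `^ q <= `|y - y0|].

Definition isolated_calm (q : R) (S : Y -> set X) (y0 : Y) (x0 : X) : Prop :=
  exists tau : R, isolated_calm_with q tau S y0 x0.

(* Admissible moduli are positive, so adjoining 0 to the set only fixes the
   supremum of the empty set as 0. *)
Definition clm (q : R) (S : Y -> set X) (y0 : Y) (x0 : X) : \bar R :=
  ereal_sup (0%E |` [set tau%:E | tau in
                    [set tau : R | isolated_calm_with q tau S y0 x0]]).

Definition sharp_minimizer (q : R) (f : X -> R) (x0 : X) : Prop :=
  exists2 tau : R, 0 < tau & exists2 U : set X, nbhs x0 U &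
    forall x, U x -> tau * `|x - x0| `^ q <= f x - f x0.

Definition lower_dq (q : R) (f : X -> R) (x0 x : X) : \bar R :=
  limf_einf (fun p : X * R => ((f (x0 + p.2 *: p.1) - f x0) / p.2 `^ q)%:E)
            (filter_prod (nbhs x) (0^'+)).

Definition lower_dq_norm (q : R) (f : X -> R) (x0 : X) : \bar R :=
  ereal_inf [set maxe 0%E (lower_dq q f x0 x) | x in
              [set x : X | `|x| = 1]].

End GrowthNotions.

Section GraphicalDerivative.
Context (U W : normedModType R).

(* [ts] decreasing to 0 is read as: positive and convergent to 0; passing to a
   subsequence makes it monotone. *)
Definition graph_deriv (r : R) (F : U -> set W) (u0 : U) (w0 : W) : U -> set W :=
  fun u => [set w | exists (us : nat -> U) (ws : nat -> W) (ts : nat -> R),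
    [/\ us @ \oo --> u, ws @ \oo --> w, ts @ \oo --> (0 : R),
        forall k, 0 < ts k &
        forall k, F (u0 + ts k *: us k) (w0 + ts k `^ r *: ws k)]].

(* In \bar R, 0^-1 = +oo and a * +oo = +oo for a > 0; (0, 0) being excluded, the
   indeterminate 0 / 0 does not occur. The ratios are nonnegative, so adjoining
   0 only fixes the supremum of the empty set as 0. *)
Definition outer_norm (r : R) (H : U -> set W) : \bar R :=
  ereal_sup (0%E |` [set (`|p.2|%:E / (`|p.1| `^ r)%:E)%E | p in
                    [set p : U * W | H p.1 p.2 /\ p <> (0, 0)]]).

End GraphicalDerivative.

(* x `^ (- q) for q > 0, with 0 `^ (- q) = +oo and +oo `^ (- q) = 0, which is
   not the convention of [poweR] at negative exponents. *)
Definition epowN (x : \bar R) (q : R) : \bar R := ((x `^ q)^-1)%E.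

End LocalNotions.

Section Euclidean.
Context (R : realType) (n : nat).
Local Notation E := (euclid R n).

Definition subdifferential (f : E -> R) (x : E) : set E :=
  [set v | forall y, dot v (y - x) <= f y - f x].

Definition pos_definite (r : R) (H : E -> set E) : Prop :=
  exists2 lambda : R, 0 < lambda &
    forall x v, H x v -> lambda * `|x| `^ (r + 1) <= dot v x.

End Euclidean.

Section SemiInfiniteProgram.
Context (R : realType) (n : nat) (T : topologicalType) (cT : compact [set: T]).
Local Notation E := (euclid R n).
Local Notation C := (@ctsfun R T cT).
Context (a : T -> E).

Definition feasible (b : C) : set E := [set x | forall t, dot (a t) x <= b t].

Definition slater (b : C) : Prop := exists x : E, forall t, dot (a t) x < b t.

Definition solutions (p : E * C) : set E :=
  [set x | feasible p.2 x /\
           forall y, feasible p.2 y -> dot p.1 x <= dot p.1 y].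

Definition solutions_at (c : E) (b : C) : set E := solutions (c, b).

Definition level_set (c : E) (p : R * C) : set E :=
  [set x | feasible p.2 x /\ dot c x <= p.1].

(* The supremum over T is attained when T is nonempty and a is continuous. *)
Definition max_fun (c : E) (b : C) (x0 x : E) : R :=
  Num.max (dot c (x - x0)) (sup [set dot (a t) x - b t | t in [set: T]]).

End SemiInfiniteProgram.

(* Main.v *)
(* Assertions (i)-(v) are all compared with (iv). Since x is optimal,
   f >= 0 = f x. A point y of a perturbed level set or solution set has
   f y bounded by a multiple of the perturbation: for the level set this is
   immediate, for S(c', b') one compares y with the point of the segment from x
   to the Slater point that is feasible for b'. Conversely every y belongs to the
   level set of a perturbation of size f y. The key step is (ii) => (iv). The
   Slater condition gives Karush-Kuhn-Tucker multipliers
   - c = sum_i l_i a_{s_i} at x, and <a_{s_i}, y> >= b_{s_i} - K f y whenever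
   l_i > 0; hence with b' = max(<a_., y>, b - K f y) the constraints s_i are
   active at y, so that y solves P(c, b'), while |b' - b| <= K f y.
   Assertions (v), (vi), (vii) are limiting forms of a growth inequality along
   x + t u; they imply it back by compactness of the set of admissible (u, w),
   for (vi) because the balls of C(T, R) are compact when T is finite. For (vii)
   a point y violating the growth inequality is replaced by the minimizer z of
   f + k |. - y|^2, which has a small subgradient and lies on the same scale. *)

Require Import Defs.
From mathcomp Require Import all_boot all_order all_algebra.
From mathcomp Require Import all_classical all_reals all_analysis.
From mathcomp Require Import ring lra.

Set Implicit Arguments.
Unset Strict Implicit.
Unset Printing Implicit Defensive.

Import Order.TTheory GRing.Theory Num.Theory.
Import numFieldNormedType.Exports.

Local Open Scope classical_set_scope.
Local Open Scope ring_scope.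

(** * Inner product and compactness in Euclidean space *)

Section EuclideanSpace.
Context (R : realType) (n : nat).
Local Notation E := (euclid R n).
Implicit Types x y z : E.

Lemma dotN x y : dot (- x) y = - dot x y.
Proof. by rewrite -scaleN1r dotZl mulN1r. Qed.

Lemma dotNr x y : dot x (- y) = - dot x y.
Proof. by rewrite dotC dotN dotC. Qed.

Lemma dotBl x y z : dot (x - y) z = dot x z - dot y z.
Proof. by rewrite dotDl dotN. Qed.

Lemma dotBr x y z : dot x (y - z) = dot x y - dot x z.
Proof. by rewrite dotC dotBl !(dotC x). Qed.

Lemma dot0r x : dot x 0 = 0.
Proof. by rewrite -(scale0r x) dotZr mul0r. Qed.

Lemma dot_suml (I : Type) (s : seq I) (v : I -> E) z :
  dot (\sum_(i <- s) v i) z = \sum_(i <- s) dot (v i) z.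
Proof.
apply: (big_morph (fun v => dot v z)) => [x y|]; first exact: dotDl.
by rewrite dotC dot0r.
Qed.

Lemma dotxx x : dot x x = `|x| ^+ 2.
Proof. by rewrite -[`|x|]/(enorm x) sqr_sqrtr// dot_ge0. Qed.

Lemma ler_norm_dot x y : `|dot x y| <= `|x| * `|y|.
Proof.
rewrite -(@ler_pXn2r _ 2)// ?nnegrE ?mulr_ge0// exprMn -!dotxx real_normK ?num_real//.
exact: dot_CauchySchwarz.
Qed.

Lemma ler_dot x y : dot x y <= `|x| * `|y|.
Proof. exact: le_trans (ler_norm _) (ler_norm_dot x y). Qed.

Lemma cvg_dotl (I : Type) (F : set_system I) (f : I -> E) x z :
  Filter F -> f @ F --> x -> dot (f i) z @[i --> F] --> dot x z.
Proof.
move=> FF fx; apply/cvgrPdist_le => e e0.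
have z1 : 0 < `|z| + 1 by rewrite ltr_wpDl.
have /cvgrPdist_le/(_ (e / (`|z| + 1))) := fx.
rewrite divr_gt0// => /(_ isT); apply: filterS => i xi.
rewrite -dotBl (le_trans (ler_norm_dot _ _))//.
rewrite ler_pdivlMr// in xi; apply: le_trans xi.
by rewrite ler_wpM2l// lerDl.
Qed.

Lemma euclid_coord x i : `|(x : 'rV[R]_n) 0 i| <= `|x|.
Proof.
rewrite -(@ler_pXn2r _ 2)// ?nnegrE// real_normK ?num_real// -dotxx /dot.
by rewrite (bigD1 i)//= -expr2 lerDl sumr_ge0// => j _; rewrite -expr2 sqr_ge0.
Qed.

Lemma euclid_id_continuous : continuous (id : 'rV[R]_n -> E).
Proof.
have -> : (id : 'rV[R]_n -> E) =
    (fun v : 'rV[R]_n => \sum_(i < n) v 0 i *: (delta_mx 0 i : E)).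
  by apply/funext => v; exact: row_sum_delta.
apply: (continuous_big (@add_continuous E)) => i _ v.
by apply: (@cvgZr_tmp _ _ _ (nbhs v)); exact: coord_continuous.
Qed.

(** The identity from the maximum norm to the Euclidean norm is continuous, so the compact box
    [-M, M]^n stays compact and contains [A]. *)
Lemma euclid_compact (A : set E) (M : R) :
  closed A -> A `<=` [set x | `|x| <= M] -> compact A.
Proof.
move=> clA AM.
pose B := [set v : 'rV[R]_n | forall i, `[- M, M]%classic (v ord0 i)].
apply: (@subclosed_compact _ _ ((id : 'rV[R]_n -> E) @` B)) => //.
  apply: continuous_compact.
    by apply: continuous_subspaceT; exact: euclid_id_continuous.
  by apply: (@rV_compact _ _ (fun=> `[- M, M]%classic)) => i; exact: segment_compact.
move=> x /AM xM; exists x => // i; rewrite /= in_itv/= -ler_norml.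
exact: le_trans (euclid_coord _ _) xM.
Qed.

Lemma euclid_norm_compact (A : set R) (M : R) :
  closed A -> (forall r, A r -> r <= M) -> compact [set x : E | A `|x|].
Proof.
move=> clA AM; apply: (@euclid_compact _ M) => [|x /AM//].
by apply: (preimage_closed (f := fun x : E => `|x|)) => // x _; exact: norm_continuous.
Qed.

End EuclideanSpace.

(** * Uniform thresholds on compact sets and graphical derivatives *)

Section CompactCovering.
Context (R : realType) (X : topologicalType).

Lemma compact_near_right (K : set X) (P : R -> X -> Prop) :
  compact K ->
  (forall y, K y -> \forall y' \near y & t \near 0^'+, P t y') ->
  exists2 e : R, 0 < e & forall t y, 0 < t < e -> K y -> P t y.
Proof.
move=> /compact_near_coveringP cK KP.
have : \forall t \near 0^'+, K `<=` P t by exact: cK.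
rewrite near_withinE => /nbhs_ballP[e /= e0 eP].
exists e => // t y /andP[t0 te] Ky; apply: eP => //.
by rewrite /ball/= sub0r normrN gtr0_norm.
Qed.

End CompactCovering.

Section GraphicalDerivative.
Context (R : realType) (U W : normedModType R) (r : R) (F : U -> set W).
Context (u0 : U) (w0 : W).

(** This form dispenses with sequences in later arguments; witnesses for e = 1/(k+1) give the
    sequences back. *)
Lemma graph_derivP u w : graph_deriv r F u0 w0 u w <->
  forall e : R, 0 < e -> exists u' w' t,
    [/\ `|u' - u| < e, `|w' - w| < e, 0 < t < e &
        F (u0 + t *: u') (w0 + t `^ r *: w')].
Proof.
split=> [[us [ws [ts [uu ww tt t0 Fk]]]] e e0|H].
  have [k [uk wk tk]] : exists k, [/\ `|us k - u| < e, `|ws k - w| < e & ts k < e].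
    near \oo => k; exists k; split.
    - by near: k; have /cvgrPdistC_lt := uu; apply.
    - by near: k; have /cvgrPdistC_lt := ww; apply.
    - rewrite (le_lt_trans (ler_norm _))// -(subr0 (ts k)).
      by near: k; have /cvgrPdistC_lt := tt; apply.
  by exists (us k), (ws k), (ts k); rewrite t0 tk.
have {}H (k : nat) := H k.+1%:R^-1 (ltac:(by rewrite invr_gt0 ltr0n)).
have /choice[g gP] : forall k : nat, exists p : U * W * R,
    [/\ `|p.1.1 - u| < k.+1%:R^-1, `|p.1.2 - w| < k.+1%:R^-1,
        0 < p.2 < k.+1%:R^-1 & F (u0 + p.2 *: p.1.1) (w0 + p.2 `^ r *: p.1.2)].
  by move=> k; have [u' [w' [t ?]]] := H k; exists (u', w', t).
exists (fun k => (g k).1.1), (fun k => (g k).1.2), (fun k => (g k).2).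
have lim (V : normedModType R) (h : nat -> V) (l : V) :
    (forall k, `|h k - l| < k.+1%:R^-1) -> h @ \oo --> l.
  move=> hl; apply/cvgrPdistC_lt => e e0; near=> k.
  apply: lt_trans (hl k) _; near: k.
  exact: near_infty_natSinv_lt (PosNum e0).
split.
- by apply: lim => k; have [] := gP k.
- by apply: lim => k; have [] := gP k.
- apply: (lim R^o) => k; have [_ _ /andP[t0 tk] _] := gP k.
  by rewrite subr0 gtr0_norm.
- by move=> k; have [_ _ /andP[]] := gP k.
- by move=> k; have [] := gP k.
Unshelve. all: by end_near. Qed.

(** Compactness turns the absence of tangent pairs in [K] into a uniform threshold on the scale [t].
    Conditions on derivatives return to growth estimates through this. *)
Lemma graph_derivN_compact (K : set (U * W)) :
  compact K -> (forall p, K p -> ~ graph_deriv r F u0 w0 p.1 p.2) ->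
  exists2 e : R, 0 < e & forall t p, 0 < t < e -> K p ->
    ~ F (u0 + t *: p.1) (w0 + t `^ r *: p.2).
Proof.
move=> cK KN.
pose P t (p : U * W) := ~ F (u0 + t *: p.1) (w0 + t `^ r *: p.2).
apply: (compact_near_right (P := P)) => // p Kp.
have /graph_derivP/existsNP[e /not_implyP[e0 eN]] := KN p Kp.
exists (ball p e, [set t | 0 < t < e]) => /=.
  split; first exact: nbhsx_ballx.
  apply: filterS2 (nbhs_right_lt e0) (nbhs_right_gt 0) => t te t0.
  by rewrite /= t0 te.
move=> [[u' w'] t]/= [[]] + + /andP[t0 te] Ft; rewrite -!ball_normE/= => pu pw.
by apply: eN; exists u', w', t; rewrite !(distrC _ p.1, distrC _ p.2) t0 te.
Qed.

End GraphicalDerivative.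

(** * Karush-Kuhn-Tucker multipliers *)

(** Subtracting a multiple of a linear dependence removes one of the n + 1 vectors. The conic
    weights are absorbed in [g]. *)
Lemma conic_caratheodory (R : realFieldType) (n : nat) (g : 'I_n.+1 -> 'rV[R]_n) :
  exists (i0 : 'I_n.+1) (nu : 'I_n -> R), (forall j, 0 <= nu j) /\
    \sum_i g i = \sum_j nu j *: g (lift i0 j).
Proof.
have [mu [i mui mug]] : exists mu : 'I_n.+1 -> R,
    exists2 i, 0 < mu i & \sum_i mu i *: g i = 0.
  pose A : 'M[R]_(n.+1, n) := \matrix_(i < n.+1) g i.
  have : kermx A != 0.
    by rewrite -mxrank_eq0 mxrank_ker subn_eq0 -ltnNge ltnS rank_leq_col.
  move=> /rowV0Pn[v /sub_kermxP vA v0].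
  have vg : \sum_i v 0 i *: g i = 0.
    rewrite -[RHS]vA mulmx_sum_row; apply: eq_bigr => i _.
    by congr (_ *: _); apply/rowP => j; rewrite !mxE.
  have /rV0Pn[i vi] := v0.
  have [vi0|vi0] := ltP 0 (v 0 i); first by exists (v 0); [exists i].
  exists (fun i => - v 0 i); exists i; first by rewrite oppr_gt0 lt_def eq_sym vi.
  by under eq_bigr do rewrite scaleNr; rewrite sumrN vg oppr0.
(* Dividing by the largest coefficient of a linear relation with a positive
   coefficient makes all the coefficients 1 - mu_i / mu_i0 nonnegative. *)
pose i0 := [arg max_(j > i) mu j]%O.
have [mu0 mui0] : 0 < mu i0 /\ forall j, mu j <= mu i0.
  rewrite /i0; case: arg_maxP => //= j _ jmax; split=> [|k]; last exact: jmax.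
  exact: lt_le_trans (jmax i isT).
exists i0, (fun j => 1 - mu (lift i0 j) / mu i0); split=> [j|].
  by rewrite subr_ge0 ler_pdivrMr// mul1r.
transitivity (\sum_i (1 - mu i / mu i0) *: g i).
  under [RHS]eq_bigr do rewrite scalerBl scale1r mulrC -scalerA.
  by rewrite sumrB -scaler_sumr mug scaler0 subr0.
by rewrite (bigD1_ord i0)//= divff ?gt_eqF// subrr scale0r add0r.
Qed.

Lemma linear_ge0_of_quadratic (R : realFieldType) (A B : R) : 0 <= B ->
  (forall s, 0 < s <= 1 -> 0 <= s * A + s ^+ 2 * B) -> 0 <= A.
Proof.
move=> B0 AB; rewrite leNgt; apply/negP => A0.
have k0 : 0 < B + 1 by rewrite ltr_wpDl.
pose s := Num.min 1 (- A / (B + 1)).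
have s0 : 0 < s by rewrite lt_min ltr01 divr_gt0// oppr_gt0.
have /AB : 0 < s <= 1 by rewrite s0 ge_min lexx.
rewrite expr2 -mulrA -mulrDr pmulr_rge0// leNgt => /negP; apply.
have : s * B < s * (B + 1) by rewrite ltr_pM2l// ltrDl.
have : s * (B + 1) <= - A by rewrite -ler_pdivlMr// ge_min lexx orbT.
lra.
Qed.

Section KarushKuhnTucker.
Context (R : realType) (n : nat) (T : topologicalType) (cT : compact [set: T]).
Context (T0 : [set: T] !=set0) (a : T -> euclid R n) (ca : continuous a).
Local Notation E := (euclid R n).
Local Notation C := (@ctsfun R T cT).
Implicit Types (b : C) (c x y : E).

Lemma dot_a_continuous y : continuous (fun t => dot (a t) y).
Proof. by move=> t; apply: cvg_dotl; exact: ca. Qed.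

Lemma slack_continuous b y : continuous (fun t => b t - dot (a t) y).
Proof.
move=> t; apply: cvgB; [exact: ctsfun_continuous|exact: dot_a_continuous].
Qed.

(** The slack is continuous and attains a positive minimum on the compact [T]. *)
Lemma slater_slack b : slater a b ->
  exists xh, exists2 d, 0 < d & forall t, dot (a t) xh <= b t - d.
Proof.
move=> [xh xhb]; exists xh.
have [t _ tmin] := compact_EVT_min T0 cT (continuous_subspaceT (@slack_continuous b xh)).
exists (b t - dot (a t) xh); first by rewrite subr_gt0.
by move=> s; have := tmin s (in_setT s); lra.
Qed.

(* Complementary slackness: inactive indices are allowed with weight 0, so that
   the case without active constraints needs no separate treatment. *)
Definition multipliers b x (m : nat) (l : 'I_m -> R) (s : 'I_m -> T) :=
  forall i, 0 <= l i /\ l i * (b (s i) - dot (a (s i)) x) = 0.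

Definition lagrangian_grad c (m : nat) (l : 'I_m -> R) (s : 'I_m -> T) : E :=
  \sum_i l i *: a (s i) + c.

(** Paired with xh - x, each weighted active gradient contributes at most - l_i d, so no
    cancellation occurs and a bound on the sum limits every weight. *)
Lemma multipliers_bounded b c x : slater a b ->
  exists M : R, forall m (l : 'I_m -> R) s, multipliers b x l s ->
    `|lagrangian_grad c l s| <= `|c| -> forall i, l i <= M.
Proof.
move=> /slater_slack[xh [d d0 xhb]].
exists (2 * `|c| * `|xh - x| / d) => m l s lsP gc i.
rewrite ler_pdivlMr//.
have gn : `|\sum_i l i *: a (s i)| <= 2 * `|c|.
  rewrite -[X in `|X|](addrK c) (le_trans (ler_normB _ _))//.
  by rewrite mulrDl mul1r lerD2r.
have ld j : l j * d <= - dot (l j *: a (s j)) (xh - x).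
  have [lj0 ljs] := lsP j.
  have := ler_wpM2l lj0 (xhb (s j)); rewrite dotZl dotBr.
  by move: ljs; rewrite !mulrBr => ? ?; lra.
apply: (@le_trans _ _ (- dot (\sum_i l i *: a (s i)) (xh - x))); last first.
  rewrite -dotN (le_trans (ler_dot _ _))// normrN.
  by rewrite ler_wpM2r.
rewrite dot_suml -sumrN (bigD1 i)//= (le_trans (ld i))// lerDl.
apply: sumr_ge0 => j _; apply: le_trans (ld j).
by have [lj0 _] := lsP j; rewrite mulr_ge0// ltW.
Qed.

Lemma multipliers_argmin b c x : slater a b ->
  exists (l : 'I_n -> R) s, multipliers b x l s /\
    forall l' s', multipliers b x l' s' ->
      `|lagrangian_grad c l s| <= `|lagrangian_grad c (l' : 'I_n -> R) s'|.
Proof.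
move=> /(multipliers_bounded c x)[M MP].
(* The maximum with 0 keeps the zero weights admissible, the sign of [M] being unknown here. *)
pose A := [set p : R * T | 0 <= p.1 <= Num.max 0 M] `&`
  [set p : R * T | p.1 * (b p.2 - dot (a p.2) x) = 0].
have cA : compact A.
  apply: compact_closedI.
    rewrite (_ : mkset _ = `[0, Num.max 0 M]%classic `*` setT).
      by apply: compact_setX => //; exact: segment_compact.
    by apply/seteqP; split=> p; rewrite /setX/= in_itv/=; [move=> ->|case].
  pose h (p : R * T) := p.1 * (b p.2 - dot (a p.2) x).
  rewrite (_ : mkset _ = h @^-1` [set 0])//.
  apply: preimage_closed; last exact: closed_eq.
  move=> p _; apply: cvgM; first exact: cvg_fst.
  apply: (@continuous_comp _ _ _ snd (fun t => b t - dot (a t) x)).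
    exact: cvg_snd.
  exact: slack_continuous.
(* n terms suffice: competitors with n + 1 terms are handled by [multipliers_add],
   through Caratheodory's theorem. *)
pose P := prod_topology (fun _ : 'I_n => (R * T)%type).
pose B : set P := [set f | forall i, A (f i)].
have cB : compact B by exact: (@tychonoff _ _ (fun=> A)).
pose phi (f : P) := `|lagrangian_grad c (fun i => (f i).1) (fun i => (f i).2)|.
have phic : continuous phi.
  have sumc : continuous (fun f : P => \sum_i (f i).1 *: a (f i).2 : E).
    apply: (continuous_big (@add_continuous E)) => i _ f.
    have pf := @proj_continuous 'I_n (fun=> (R * T)%type) i f.
    apply: (@cvgZ _ _ _ (nbhs f)).
      by apply: (@continuous_comp P _ _ (proj i) fst) => //; exact: cvg_fst.
    apply: (@continuous_comp P _ _ (proj i) (a \o snd)) => //.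
    by apply: (@continuous_comp _ _ _ snd a); [exact: cvg_snd|exact: ca].
  move=> f; apply: (@cvg_norm _ E _ (nbhs f)).
  by apply: (@cvgD _ E _ (nbhs f) _ _ (fun=> c) _ _ (sumc f)); exact: cvg_cst.
have [t0 _] := T0.
have B0 : B (fun=> (0, t0)).
  by move=> i; split; rewrite /= ?mul0r// lexx le_max lexx.
have Bn : B !=set0 by exists (fun=> (0, t0)).
have [f fB fmin] := compact_EVT_min Bn cB (continuous_subspaceT phic).
rewrite inE in fB.
exists (fun i => (f i).1), (fun i => (f i).2); split=> [i|l' s' lsP'].
  by have [/= /andP[]] := fB i.
(* Weights whose gradient exceeds |c| in norm may leave the compact set, but they lose to the zero
   weights, whose gradient is [c]. *)
have [gc|/ltW cg] := leP (`|lagrangian_grad c l' s'|) (`|c|).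
  apply: (fmin (fun i => (l' i, s' i))); rewrite inE => i.
  have [l0 ls] := lsP' i; split => //=.
  by rewrite l0 le_max (MP _ _ _ lsP' gc) orbT.
apply: le_trans cg; apply: le_trans (fmin _ (mem_set B0)) _.
by rewrite /phi /lagrangian_grad big1 ?add0r// => i _; rewrite scale0r.
Qed.

Lemma multipliers_add b x (l : 'I_n -> R) s t (e : R) :
  multipliers b x l s -> 0 <= e -> b t = dot (a t) x ->
  exists (l' : 'I_n -> R) s', multipliers b x l' s' /\
    \sum_i l' i *: a (s' i) = \sum_i l i *: a (s i) + e *: a t.
Proof.
move=> lsP e0 bt.
pose l1 (i : 'I_n.+1) := if unlift ord0 i is Some j then l j else e.
pose s1 (i : 'I_n.+1) := if unlift ord0 i is Some j then s j else t.
have l1P : multipliers b x l1 s1.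
  by move=> i; rewrite /l1 /s1; case: unliftP => // _; rewrite bt subrr mulr0.
have [i0 [nu [nu0 sumE]]] := conic_caratheodory (fun i => l1 i *: a (s1 i)).
exists (fun j => nu j * l1 (lift i0 j)), (fun j => s1 (lift i0 j)); split.
  move=> j; have [l10 l1s] := l1P (lift i0 j).
  by rewrite mulr_ge0// -mulrA l1s mulr0.
under eq_bigr do rewrite -scalerA.
rewrite -[LHS]sumE big_ord_recl /l1 /s1 unlift_none addrC; congr (_ + _).
by apply: eq_bigr => j _; rewrite liftK.
Qed.

(** Near an active index [d] decreases the constraint; near an inactive one the slack persists for
    short steps. Compactness of [T] yields a common step. *)
Lemma feasible_descent b x d : feasible a b x ->
  (forall t, b t = dot (a t) x -> dot (a t) d < 0) ->
  exists2 s : R, 0 < s & feasible a b (x + s *: d).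
Proof.
move=> xb ad.
have [|e e0 eP] := @compact_near_right R T setT
    (fun s t => dot (a t) (x + s *: d) <= b t) cT; last first.
  exists (e / 2) => [|t]; first by rewrite divr_gt0.
  by apply: eP => //; rewrite divr_gt0//= gtr_pMr// invf_lt1// ltr1n.
move=> t _.
have [bt|bt] := eqVneq (b t) (dot (a t) x).
  exists ([set s | dot (a s) d < 0], [set s | 0 < s]) => /=.
    split; last exact: nbhs_right_gt.
    have /cvgr_lt := @dot_a_continuous d t; apply; exact: ad.
  move=> [s r]/= [sd r0]; rewrite dotDr dotZr -[leRHS]addr0.
  by rewrite lerD ?xb// pmulr_rle0 ?ltW.
have bt0 : 0 < b t - dot (a t) x by rewrite subr_gt0 lt_def bt xb.
pose k := `|dot (a t) d| + 1.
have k0 : 0 < k by rewrite ltr_wpDl.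
(* Near [t] at least half of the slack remains, while the constraint grows at a rate below [k]. *)
exists ([set s | (b t - dot (a t) x) / 2 < b s - dot (a s) x] `&`
        [set s | dot (a s) d < k],
        [set r | 0 < r] `&` [set r | r < (b t - dot (a t) x) / 2 / k]) => /=.
  split; apply: filterI.
  - have /cvgr_gt := @slack_continuous b x t; apply.
    by rewrite gtr_pMr// invf_lt1// ltr1n.
  - have /cvgr_lt := @dot_a_continuous d t; apply.
    by rewrite (le_lt_trans (ler_norm _))// ltrDl.
  - exact: nbhs_right_gt.
  - by apply: nbhs_right_lt; rewrite !divr_gt0.
move=> [s r]/= [[sb sd] [r0]]; rewrite ltr_pdivlMr// => rk.
rewrite dotDr dotZr.
have : r * dot (a s) d <= r * k by rewrite ler_pM2l// ltW.
lra.
Qed.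

(** First-order condition for the squared norm at e = 0. *)
Lemma dot_ge0_of_norm_min (z v : E) :
  (forall e, 0 < e <= 1 -> `|z| <= `|z + e *: v|) -> 0 <= dot z v.
Proof.
move=> zv; rewrite -(@pmulr_rge0 _ 2)//.
apply: (@linear_ge0_of_quadratic _ _ (dot v v)) => [|e e01]; first exact: dot_ge0.
have := zv e e01; rewrite -(@ler_pXn2r _ 2)// ?nnegrE// -!dotxx.
rewrite !(dotDl, dotDr, dotZl, dotZr) (dotC v z) -subr_ge0 => h.
by apply: le_trans h _; rewrite le_eqVlt; apply/orP; left; apply/eqP; ring.
Qed.

Lemma kkt_multipliers b c x : slater a b -> solutions a (c, b) x ->
  exists (l : 'I_n -> R) s, multipliers b x l s /\
    c = - \sum_i l i *: a (s i).
Proof.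
move=> sb [/= xb xmin].
(* If the element D = p + c of least norm were nonzero, then - D, tilted towards
   the Slater point, would be a feasible descent direction at x. *)
have [l [s [lsP lmin]]] := multipliers_argmin c x sb.
exists l, s; split=> //; apply/eqP; rewrite -addr_eq0 addrC.
rewrite -[X in X == _]/(lagrangian_grad c l s).
set p := \sum_i l i *: a (s i); set D := lagrangian_grad c l s.
have DE : D = p + c by [].
apply: contraT => D0.
(* [Da] and [Dp] are optimality conditions for the least norm: adding a multiple of an active
   gradient, or shrinking all weights, gives a competitor. *)
have Da t : b t = dot (a t) x -> 0 <= dot D (a t).
  move=> bt; apply: dot_ge0_of_norm_min => e /andP[e0 _].
  have [l' [s' [lsP' ls']]] := multipliers_add lsP (ltW e0) bt.
  have := lmin _ _ lsP'; rewrite /lagrangian_grad ls'.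
  by rewrite -/p addrAC.
have Dp : 0 <= dot D (- p).
  apply: dot_ge0_of_norm_min => e /andP[e0 e1].
  have lsP' : multipliers b x (fun i => (1 - e) * l i) s.
    move=> i; have [li0 lis] := lsP i.
    by rewrite mulr_ge0 ?subr_ge0// -mulrA lis mulr0.
  have := lmin _ _ lsP'; rewrite /lagrangian_grad -/p.
  under eq_bigr do rewrite -scalerA.
  rewrite -scaler_sumr -/p scalerBl scale1r scalerN.
  by rewrite addrAC.
have DD : 0 < `|D| ^+ 2 by rewrite exprn_gt0// normr_gt0.
have cD : `|D| ^+ 2 <= dot c D.
  have -> : c = D - p by rewrite DE addrAC subrr add0r.
  by rewrite dotBl dotxx lerDl -dotN dotC.
have [xh [d d0 xhb]] := slater_slack sb.
(* With h = |D|^2 / k, the cost h <c, xh - x> of the tilt stays below |D|^2, a lower bound for the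
   decrease along - D. *)
pose k := `|c| * `|xh - x| + 1.
have k0 : 0 < k by rewrite ltr_wpDl// mulr_ge0.
pose h := `|D| ^+ 2 / k.
have h0 : 0 < h by rewrite divr_gt0.
have [t bt|r r0 rb] := @feasible_descent b x (- D + h *: (xh - x)) xb.
  rewrite dotDr dotZr dotC dotN dotC.
  have aD : - dot (a t) D <= 0 by rewrite oppr_le0 dotC Da.
  rewrite (le_lt_trans (lerD aD (lexx _)))// add0r pmulr_rlt0// dotBr -bt.
  by have := xhb t; lra.
have := xmin _ rb; rewrite /= dotDr lerDl dotZr pmulr_rge0//.
rewrite dotDr dotZr dotC dotN dotC leNgt => /negP[].
have : h * dot c (xh - x) < `|D| ^+ 2.
  apply: (@le_lt_trans _ _ (h * (`|c| * `|xh - x|))).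
    by rewrite ler_pM2l// ler_dot.
  by rewrite -[ltRHS](mulfVK (lt0r_neq0 k0)) -/h ltr_pM2l// ltrDl.
lra.
Qed.

End KarushKuhnTucker.

(** * Transfer between growth of a function and isolated calmness *)

Section CalmnessAndSharpness.
Context (R : realType) (X Y : normedModType R) (q : R).
Context (S : Y -> set X) (y0 : Y) (x0 : X) (f : X -> R) (K : R).
Context (K0 : 0 < K) (fx0 : f x0 = 0).

Lemma isolated_calm_of_sharp : sharp_minimizer q f x0 ->
  (exists U V, [/\ nbhs x0 U, nbhs y0 V &
    forall y x, V y -> S y x -> U x -> f x <= K * `|y - y0|]) ->
  isolated_calm q S y0 x0.
Proof.
move=> [tau tau0 [U xU tauU]] [U' [V [xU' yV fK]]].
exists (tau / K); split; first exact: divr_gt0.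
exists (U `&` U'), V; split=> // [|y x Vy Sy [/tauU + U'x]]; first exact: filterI.
rewrite fx0 subr0 mulrAC ler_pdivrMr// mulrC (mulrC `|_|).
by move=> /le_trans; apply; exact: fK.
Qed.

(** Continuity of [f] at [x0] makes the parameter [y] attached to a nearby [x] fall into the
    neighbourhood where calmness applies. *)
Lemma sharp_of_isolated_calm : f x @[x --> x0] --> (0 : R) ->
  isolated_calm q S y0 x0 ->
  (forall x, exists2 y, S y x & `|y - y0| <= K * f x) ->
  sharp_minimizer q f x0.
Proof.
move=> f0 [tau [tau0 [U [V [xU /nbhs_ballP[e /= e0 eV] tauUV]]]]] fK.
exists (tau / K); first exact: divr_gt0.
exists (U `&` [set x | f x < e / K]).
  by apply: filterI => //; have /cvgr_lt := f0; apply; exact: divr_gt0.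
move=> x [Ux]/=; rewrite ltr_pdivlMr// mulrC fx0 subr0 => fe.
have [y Sy yf] := fK x.
rewrite mulrAC ler_pdivrMr// (mulrC (f x)); apply: (le_trans _ yf).
apply: tauUV => //; apply: eV; rewrite -ball_normE/= distrC.
exact: le_lt_trans yf fe.
Qed.

End CalmnessAndSharpness.

(** * Elementary properties of the function f *)

Section MaxFunction.
Context (R : realType) (n : nat) (T : topologicalType) (cT : compact [set: T]).
Context (T0 : [set: T] !=set0) (a : T -> euclid R n) (ca : continuous a).
Local Notation E := (euclid R n).
Local Notation C := (@ctsfun R T cT).

Lemma ctsfun_ex (g : T -> R) : continuous g -> exists d : C, forall t, d t = g t.
Proof. by move=> cg; exists (mkcts cg : continuousType T R). Qed.

Lemma ler_ctsfun_dist (b d : C) (M : R) : 0 <= M ->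
  (forall t, `|b t - d t| <= M) -> `|b - d| <= M.
Proof. by move=> M0 bd; exact: supnorm_le. Qed.

Lemma ctsfun_dist (b d : C) t : `|b t - d t| <= `|b - d|.
Proof. exact: (supnorm_ub (b - d) t). Qed.

Context (c : E) (b : C) (x : E) (hx : solutions a (c, b) x).
Local Notation f := (max_fun a c b x).

(** The supremum is over a nonempty bounded set because [T] is nonempty and compact. Later estimates
    of f rest on this description. *)
Lemma max_fun_leP y M :
  f y <= M <-> dot c (y - x) <= M /\ forall t, dot (a t) y - b t <= M.
Proof.
rewrite /max_fun ge_max; split=> [/andP[-> aM]|[-> aM]] /=.
  split=> // t; apply: le_trans aM; apply: sup_upper_bound; last by exists t.
  apply: compact_has_sup; first by exists (dot (a t) y - b t), t.
  apply: (@continuous_compact T R (fun t => dot (a t) y - b t)) => //.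
  apply: continuous_subspaceT => s.
  by apply: cvgB; [exact: dot_a_continuous|exact: ctsfun_continuous].
have [t0 _] := T0.
by apply: ge_sup => [|_ [t _ <-]]; [exists (dot (a t0) y - b t0), t0|exact: aM].
Qed.

Lemma max_fun_obj y : dot c (y - x) <= f y.
Proof. by have [/(_ (lexx _))[]] := max_fun_leP y (f y). Qed.

Lemma max_fun_constr y t : dot (a t) y - b t <= f y.
Proof. by have [/(_ (lexx _))[]] := max_fun_leP y (f y). Qed.

(** A negative value would make [y] feasible and strictly cheaper than the optimal [x]. *)
Lemma max_fun_ge0 y : 0 <= f y.
Proof.
rewrite leNgt; apply/negP => fy.
have [_ xmin] := hx.
have /xmin/= : feasible a b y.
  by move=> t; rewrite -subr_le0 (le_trans (max_fun_constr y t))// ltW.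
rewrite -subr_ge0 -dotBr leNgt => /negP; apply.
exact: le_lt_trans (max_fun_obj y) fy.
Qed.

Lemma max_fun0 : f x = 0.
Proof.
apply/eqP; rewrite eq_le max_fun_ge0 andbT; apply/max_fun_leP; split.
  by rewrite subrr dot0r.
by move=> t; rewrite subr_le0; have [+ _] := hx; apply.
Qed.

Lemma max_fun_lipschitz : exists2 L, 0 < L &
  forall y z, f y <= f z + L * `|y - z|.
Proof.
have cna : continuous (fun t => `|a t|) by move=> t; apply: cvg_norm; exact: ca.
have [t _ tmax] := compact_EVT_max T0 cT (continuous_subspaceT cna).
exists (`|c| + `|a t| + 1); first by rewrite ltr_wpDl// addr_ge0.
move=> y z; apply/max_fun_leP; split.
  have -> : y - x = (z - x) + (y - z) by rewrite [RHS]addrC addrA subrK.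
  rewrite dotDr lerD ?max_fun_obj// (le_trans (ler_dot _ _))//.
  by rewrite ler_wpM2r// -addrA lerDl addr_ge0.
move=> s; have -> : dot (a s) y = dot (a s) z + dot (a s) (y - z).
  by rewrite -dotDr addrC subrK.
rewrite addrAC lerD ?max_fun_constr// (le_trans (ler_dot _ _))//.
rewrite ler_wpM2r// (le_trans (tmax s (in_setT s)))//.
by rewrite addrAC lerDr addr_ge0.
Qed.

Lemma max_fun_continuous : continuous f.
Proof.
have [L L0 fL] := max_fun_lipschitz.
move=> y; apply/(@cvgrPdist_lt _ _ _ (nbhs y)) => e e0.
near=> z.
have zy : L * `|y - z| < e.
  rewrite mulrC -ltr_pdivlMr//; near: z; apply/nbhs_ballP.
  exists (e / L); first exact: divr_gt0.
  by move=> z; rewrite -ball_normE.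
have := fL y z; have := fL z y; rewrite (distrC z y) ltr_norml; lra.
Unshelve. all: by end_near. Qed.

Lemma max_fun_convex y z (s : R) : 0 <= s <= 1 ->
  f (y + s *: (z - y)) <= f y + s * (f z - f y).
Proof.
move=> /andP[s0 s1].
have comb (u v : R) : u <= f y -> v <= f z -> u + s * (v - u) <= f y + s * (f z - f y).
  move=> uy vz; rewrite -subr_ge0.
  have -> : f y + s * (f z - f y) - (u + s * (v - u)) =
    (1 - s) * (f y - u) + s * (f z - v) by ring.
  by rewrite addr_ge0// mulr_ge0 ?subr_ge0.
apply/max_fun_leP; split=> [|t].
  have -> : dot c (y + s *: (z - y) - x) =
      dot c (y - x) + s * (dot c (z - x) - dot c (y - x)).
    by rewrite !(dotDr, dotNr, dotZr); ring.
  exact: comb (max_fun_obj y) (max_fun_obj z).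
have -> : dot (a t) (y + s *: (z - y)) - b t =
    dot (a t) y - b t + s * (dot (a t) z - b t - (dot (a t) y - b t)).
  by rewrite !(dotDr, dotNr, dotZr); ring.
exact: comb (max_fun_constr y t) (max_fun_constr z t).
Qed.

End MaxFunction.

(** * Isolated calmness and sharp minimizers *)

Section CalmnessEquivalences.
Context (R : realType) (n : nat) (T : topologicalType) (cT : compact [set: T]).
Context (T0 : [set: T] !=set0) (a : T -> euclid R n) (ca : continuous a).
Local Notation E := (euclid R n).
Local Notation C := (@ctsfun R T cT).
Context (c : E) (b : C) (x : E) (hx : solutions a (c, b) x) (q : R).
Local Notation f := (max_fun a c b x).

Let f0 : f y @[y --> x] --> (0 : R).
Proof. by rewrite -(max_fun0 T0 ca hx); exact: max_fun_continuous. Qed.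

Let prod_distP (V W : normedModType R) (p p' : V * W) (M : R) :
  `|p - p'| <= M <-> `|p.1 - p'.1| <= M /\ `|p.2 - p'.2| <= M.
Proof. by rewrite prod_normE ge_max; split=> [/andP[]|[-> ->]]. Qed.

Lemma level_set_calm_of_sharp : sharp_minimizer q f x ->
  isolated_calm q (level_set a c) (dot c x, b) x.
Proof.
move=> fsharp; apply: (isolated_calm_of_sharp ltr01 (max_fun0 T0 ca hx) fsharp).
exists setT, setT; split; try exact: filterT.
move=> p y _ [/= yd yal] _; rewrite mul1r.
have [/= p1 p2] := (prod_distP p (dot c x, b) _).1 (lexx _).
apply/max_fun_leP => //; split=> [|t].
  apply: le_trans p1; rewrite dotBr (le_trans _ (ler_norm _))//.
  by rewrite lerD2r.
apply: le_trans p2; apply: le_trans (ctsfun_dist _ _ t).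
by rewrite (le_trans _ (ler_norm _))// lerD2r.
Qed.

Lemma sharp_of_level_set_calm :
  isolated_calm q (level_set a c) (dot c x, b) x -> sharp_minimizer q f x.
Proof.
move=> Lcalm; apply: (sharp_of_isolated_calm ltr01 (max_fun0 T0 ca hx) f0 Lcalm) => y.
have [d dE] : exists d : C, forall t, d t = b t + f y.
  by apply: ctsfun_ex => t; apply: cvgD; [exact: ctsfun_continuous|exact: cvg_cst].
have fy : 0 <= f y by exact: max_fun_ge0.
exists (dot c x + f y, d).
  split=> [t|] /=; first by rewrite dE -lerBlDl max_fun_constr.
  by rewrite -lerBlDl -dotBr max_fun_obj.
rewrite mul1r; apply/prod_distP; split=> /=.
  by rewrite addrAC subrr add0r ger0_norm.
apply: ler_ctsfun_dist => // t.
by rewrite dE addrAC subrr add0r ger0_norm.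
Qed.

Lemma solutions_calm_of_sharp : slater a b -> sharp_minimizer q f x ->
  isolated_calm q (solutions a) (c, b) x.
Proof.
move=> /(slater_slack T0 ca)[xh [d d0 xhb]] fsharp.
(* The 1 pays for the constraints, and for <c - c', y - x> with |y - x| < 1; the quotient bounds the
   change of c' on the segment towards [xh]. *)
pose K := 1 + (`|c| + 1) * `|xh - x| / d.
have K1 : 1 <= K by rewrite lerDl divr_ge0 ?mulr_ge0 ?addr_ge0// ltW.
apply: (isolated_calm_of_sharp (lt_le_trans ltr01 K1) (max_fun0 T0 ca hx) fsharp).
(* For p = (c', b') with |p - (c, b)| = N, the point x + (N / d) (xh - x) is
   feasible for b' and bounds the optimal value of P(c', b'). *)
pose e := Num.min 1 d.
have e0 : 0 < e by rewrite lt_min ltr01.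
exists (ball x 1), (ball ((c, b) : E * C) e); split; try exact: nbhsx_ballx.
move=> p y; rewrite -!ball_normE/= !(distrC (c, b), distrC x).
set N := `|p - (c, b)|; rewrite lt_min => /andP[N1 Nd] [/= yb ymin] yx.
have N0 : 0 <= N by exact: normr_ge0.
have [/= p1 p2] := (prod_distP p (c, b) _).1 (lexx N).
apply/max_fun_leP => //; split=> [|t]; last first.
  apply: (@le_trans _ _ N); last by rewrite ler_peMl.
  apply: le_trans p2; apply: le_trans (ctsfun_dist _ _ t).
  by rewrite (le_trans _ (ler_norm _))// lerD2r.
have [xb _] := hx.
have /ymin : feasible a p.2 (x + (N / d) *: (xh - x)).
  move=> t; rewrite dotDr dotZr dotBr.
  have N01 : 0 <= N / d <= 1 by rewrite divr_ge0 ?(ltW d0)//= ler_pdivrMr// mul1r ltW.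
  have := le_trans (ctsfun_dist p.2 b t) p2; rewrite ler_norml => /andP[bN _].
  have := xb t; have := xhb t => /= xht xt.
  have Nd' : N / d * d = N by rewrite mulfVK// gt_eqF.
  move: N01 => /andP[N01 N01'].
  (* Feasibility combines the slack beyond [d] at [xh] with the slack at [x]; the surplus (N / d) d
     = N absorbs the perturbation of [b]. *)
  have H1 : 0 <= N / d * (b t - d - dot (a t) xh) by rewrite mulr_ge0// subr_ge0.
  have H2 : 0 <= (1 - N / d) * (b t - dot (a t) x) by rewrite mulr_ge0// subr_ge0.
  have := addr_ge0 H1 H2.
  have -> : N / d * (b t - d - dot (a t) xh) + (1 - N / d) * (b t - dot (a t) x) =
    b t - N / d * d - (dot (a t) x + N / d * (dot (a t) xh - dot (a t) x)) by ring.
  rewrite Nd'; lra.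
rewrite dotDr dotZr => ymin'.
have -> : dot c (y - x) = dot (c - p.1) (y - x) + (dot p.1 y - dot p.1 x).
  by rewrite dotBl (dotBr p.1) subrK.
rewrite /K mulrDl mul1r lerD//.
  rewrite (le_trans (ler_dot _ _))// distrC -[leRHS]mulr1.
  by rewrite ler_pM// ltW.
rewrite (le_trans (y := N / d * dot p.1 (xh - x)))//; first by lra.
rewrite [leRHS](_ : _ = N / d * ((`|c| + 1) * `|xh - x|)); last by ring.
rewrite ler_wpM2l ?divr_ge0 ?(ltW d0)// (le_trans (ler_dot _ _))// ler_wpM2r//.
have -> : p.1 = c + (p.1 - c) by rewrite addrC subrK.
by rewrite (le_trans (ler_normD _ _))// lerD2l (le_trans p1)// ltW.
Qed.

Lemma solutions_at_calm_of_solutions_calm :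
  isolated_calm q (solutions a) (c, b) x -> isolated_calm q (solutions_at a c) b x.
Proof.
move=> [tau [tau0 [U [V [xU /nbhs_ballP[e /= e0 eV] tauUV]]]]].
have cb d : `|((c, d) : E * C) - (c, b)| = `|d - b|.
  by rewrite prod_normE/= subrr normr0; apply/max_idPr.
exists tau; split=> //; exists U, (ball b e); split=> //.
  exact: nbhsx_ballx.
move=> d y bd Sy Uy; rewrite -cb; apply: tauUV => //; apply: eV.
by rewrite -ball_normE/= distrC cb distrC; move: bd; rewrite -ball_normE.
Qed.

Lemma sharp_of_solutions_at_calm : slater a b ->
  isolated_calm q (solutions_at a c) b x -> sharp_minimizer q f x.
Proof.
move=> sb Scalm.
have [l [s [lsP cE]]] := kkt_multipliers T0 ca sb hx.
pose L := 1 + \sum_i l i.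
(* For l_i > 0 the slack at [y] is at most (L / l_i) f y, hence at most K f y. Zero weights
   contribute L / 0 = 0. *)
pose K := 1 + \sum_i L / l i.
have l0 i : 0 <= l i by have [] := lsP i.
have L0 : 0 <= L by rewrite addr_ge0// sumr_ge0.
have K1 : 1 <= K by rewrite lerDl sumr_ge0// => i _; rewrite divr_ge0.
apply: (sharp_of_isolated_calm (lt_le_trans ltr01 K1) (max_fun0 T0 ca hx) f0 Scalm) => y.
have fy : 0 <= f y by exact: max_fun_ge0.
have Kf : f y <= K * f y by rewrite ler_peMl.
have Kf0 : 0 <= K * f y by exact: le_trans Kf.
have [d dE] : exists d : C, forall t, d t = Num.max (dot (a t) y) (b t - K * f y).
  apply: ctsfun_ex => t.
  apply: (@continuous_max _ _ (fun t => dot (a t) y) (fun t => b t - K * f y)).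
    exact: dot_a_continuous.
  by apply: cvgB; [exact: ctsfun_continuous|exact: cvg_cst].
exists d; last first.
  apply: ler_ctsfun_dist => // t; rewrite dE ler_norml; apply/andP; split.
    by rewrite lerBrDl le_max lexx orbT.
  rewrite lerBlDl ge_max -lerBlDl (le_trans (max_fun_constr T0 ca c b x y t))//=.
  by rewrite lerD2l (le_trans _ Kf0)// oppr_le0.
have yl i : l i * dot (a (s i)) (y - x) = l i * (dot (a (s i)) y - b (s i)).
  have [_] := lsP i; rewrite !dotBr !mulrBr => /eqP.
  by rewrite subr_eq0 => /eqP ->.
(* The terms l_i <a_{s_i}, y - x> sum to - <c, y - x> >= - f y and are at most
   l_i (f y), so none of them is below - L (f y). *)
have lower i : - (L * f y) <= l i * (dot (a (s i)) y - b (s i)).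
  have := max_fun_obj T0 ca c b x y; rewrite {1}cE dotN dot_suml.
  under eq_bigr do rewrite dotZl yl.
  rewrite (bigD1 i)//=.
  have -> : L * f y = f y + (l i * f y + \sum_(j < n | j != i) l j * f y).
    by rewrite mulrDl mul1r mulr_suml (bigD1 i).
  have : \sum_(j < n | j != i) l j * (dot (a (s j)) y - b (s j)) <=
         \sum_(j < n | j != i) l j * f y.
    by apply: ler_sum => j _; rewrite ler_wpM2l// max_fun_constr.
  have : 0 <= l i * f y by rewrite mulr_ge0.
  move: (\sum_(j < n | _) _) (\sum_(j < n | _) _) => S1 S2.
  move: (l i * f y) (l i * _) (f y) => A B F.
  lra.
have dl i : l i * d (s i) = l i * dot (a (s i)) y.
  have [->|li] := eqVneq (l i) 0; first by rewrite !mul0r.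
  have lpos : 0 < l i by rewrite lt_def li l0.
  congr (_ * _); rewrite dE; apply/max_idPl; rewrite lerBlDl -lerBlDr.
  rewrite -(ler_pM2l lpos).
  have : L * f y <= l i * (K * f y).
    rewrite mulrA ler_wpM2r// -ler_pdivrMl// mulrC /K (bigD1 i)//=.
    by rewrite addrCA lerDl addr_ge0// sumr_ge0// => j _; rewrite divr_ge0.
  by have := lower i; rewrite !mulrBr; lra.
(* Weak duality: constraints with positive weight are active at [y] for [d], so the multipliers
   certify the optimality of [y]. *)
split=> /= [t|z zd]; first by rewrite dE le_max lexx.
rewrite cE !dotN !dot_suml lerN2; apply: ler_sum => i _.
by rewrite !dotZl -dl ler_wpM2l.
Qed.

End CalmnessEquivalences.

(** * Inequalities between powers, roots and extended reals *)

Section RealPowers.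
Context (R : realType).
Implicit Types (a s q : R).

Lemma ler_powR_root a s q : 0 < q -> 0 <= a -> 0 <= s ->
  (a `^ q <= s) = (a <= s `^ q^-1).
Proof.
move=> q0 a0 s0; have qn0 : q != 0 by rewrite gt_eqF.
have aE : a = (a `^ q) `^ q^-1 by rewrite -powRrM divff// powRr1.
have sE : s = (s `^ q^-1) `^ q by rewrite -powRrM mulVf// powRr1.
apply/idP/idP => h.
  by rewrite {1}aE ge0_ler_powR ?nnegrE ?invr_ge0 ?powR_ge0// ltW.
by rewrite {1}sE ge0_ler_powR ?nnegrE ?powR_ge0// ltW.
Qed.

Lemma ler_root_powR a s q : 0 < q -> 0 <= a -> 0 <= s ->
  (s `^ q^-1 <= a) = (s <= a `^ q).
Proof.
move=> q0 a0 s0; have qi0 : 0 < q^-1 by rewrite invr_gt0.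
by rewrite ler_powR_root// invrK.
Qed.

Local Open Scope ereal_scope.

(** Both sides are monotone in the finite positive case; N = 0 and N = +oo agree by the conventions
    of [epowN]. *)
Lemma le_epowN (N : \bar R) (t q : R) : (0 < q)%R -> (0 < t)%R -> 0 <= N ->
  (t%:E <= epowN N q) = (N <= (t^-1 `^ q^-1)%:E).
Proof.
move=> q0 t0; have qn0 : q != 0%R by rewrite gt_eqF.
have ti0 : (0 <= t^-1)%R by rewrite invr_ge0 ltW.
case: N => [a| |]//; rewrite /epowN ?lee_fin => a0; last first.
  by rewrite poweRyr// invey leye_eq lee_fin leNgt t0.
rewrite poweR_EFin inver powR_eq0 qn0 andbT.
have [->|an0] := eqVneq a 0%R; first by rewrite leey powR_ge0.
have ap : (0 < a `^ q)%R by rewrite powR_gt0// lt_def an0.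
by rewrite lee_fin -ler_powR_root// -{1}(invrK t) lef_pV2 ?posrE ?invr_gt0.
Qed.

Lemma ge_epowN (N : \bar R) (t q : R) : (0 < q)%R -> (0 < t)%R -> 0 <= N ->
  (epowN N q <= t%:E) = ((t^-1 `^ q^-1)%:E <= N).
Proof.
move=> q0 t0; have qn0 : q != 0%R by rewrite gt_eqF.
have ti0 : (0 < t^-1)%R by rewrite invr_gt0.
case: N => [a| |]//; rewrite /epowN ?lee_fin => a0; last first.
  by rewrite poweRyr// invey lee_fin ltW// leey.
rewrite poweR_EFin inver powR_eq0 qn0 andbT.
have [->|an0] := eqVneq a 0%R.
  by rewrite leNgt ltry/= leNgt powR_gt0.
have ap : (0 < a `^ q)%R by rewrite powR_gt0// lt_def an0.
rewrite lee_fin ler_root_powR// ?(ltW ti0)//.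
by rewrite -{1}(invrK t) lef_pV2 ?posrE.
Qed.

Lemma ereal_le_real (y z : \bar R) : 0 <= y ->
  (forall t : R, (0 < t)%R -> t%:E < z -> t%:E <= y) -> z <= y.
Proof.
move=> y0 H; rewrite leNgt; apply/negP => yz.
have [t yt tz] : exists2 t : R, y < t%:E & t%:E < z.
  case: y z y0 yz {H} => [y| |] [z| |]//= y0; rewrite ?lte_fin => yz.
    by exists ((y + z) / 2)%R; rewrite lte_fin; lra.
  by exists (y + 1)%R; rewrite ?ltry// lte_fin ltrDl.
have t0 : (0 < t)%R by rewrite -lte_fin (le_lt_trans y0).
by have := H t t0 tz; rewrite leNgt yt.
Qed.

End RealPowers.

(** * Lower derivatives and graphical derivatives *)

Section LowerDerivative.
Context (R : realType) (q : R) (q0 : 0 < q).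

Lemma lower_dq_norm_gt0 (X : normedModType R) (f : X -> R) (x0 : X) :
  sharp_minimizer q f x0 -> (0 < lower_dq_norm q f x0)%E.
Proof.
move=> [tau tau0 [U /nbhs_ballP[e /= e0 eU] tauU]].
(* Directions close to a unit vector have norm at least 1/2, whence the factor. *)
apply: (@lt_le_trans _ _ (tau * (1 / 2) `^ q)%:E).
  by rewrite lte_fin mulr_gt0// powR_gt0.
apply: le_ereal_inf_tmp => _ [u /= u1 <-]; rewrite le_max; apply/orP; right.
rewrite /lower_dq limf_einfE.
set V : set (X * R) := [set p | 1 / 2 <= `|p.1| <= 2 /\ 0 < p.2 < e / 2].
apply: le_trans (ereal_sup_ubound _); last first.
  exists V => //.
  exists ([set u' | 1 / 2 <= `|u'| <= 2], [set t | 0 < t < e / 2]) => //=.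
  split.
    apply/nbhs_ballP; exists (1 / 2) => [|u'] /=; first by rewrite divr_gt0.
    rewrite -ball_normE/= => uu'.
    have := lerB_dist u u'; have := lerB_dist u' u.
    by rewrite (distrC u') u1; lra.
  have e2 : 0 < e / 2 by rewrite divr_gt0.
  apply: filterS2 (nbhs_right_lt e2) (nbhs_right_gt 0) => t te t0.
  by rewrite /= t0 te.
apply: le_ereal_inf_tmp => _ [[u' t] /= [/andP[u1' u2'] /andP[t0 te]] <-].
rewrite lee_fin ler_pdivlMr ?powR_gt0//.
have /tauU : U (x0 + t *: u').
  apply: eU; rewrite -ball_normE/= opprD addrA subrr add0r normrN normrZ gtr0_norm//.
  apply: (@le_lt_trans _ _ (t * 2)); first by rewrite ler_pM2l.
  by rewrite -ltr_pdivlMr.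
apply: le_trans; rewrite addrAC subrr add0r normrZ gtr0_norm//.
rewrite -mulrA ler_pM2l// (powRM _ (ltW t0))// [leLHS]mulrC ler_pM2l ?powR_gt0//.
by rewrite ge0_ler_powR ?nnegrE// ltW.
Qed.

(** Near each unit direction the difference quotient exceeds some fixed [tau]; compactness of the
    sphere gives one step length for all directions, and y = x0 + t u with t = |y - x0|. *)
Lemma sharp_of_lower_dq_norm (n : nat) (f : euclid R n -> R) (x0 : euclid R n) :
  (0 < lower_dq_norm q f x0)%E -> sharp_minimizer q f x0.
Proof.
move=> N0.
have [tau tau0 tauN] : exists2 tau : R, 0 < tau & (tau%:E < lower_dq_norm q f x0)%E.
  case: (lower_dq_norm q f x0) N0 => [r| |]//; rewrite ?lte_fin => r0.
    by exists (r / 2); [rewrite divr_gt0|rewrite lte_fin gtr_pMr// invf_lt1// ltr1n].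
  by exists 1 => //; rewrite ltry.
have [||e e0 eP] := @compact_near_right R (euclid R n) [set u | `|u| = 1]
    (fun t u => tau * t `^ q < f (x0 + t *: u) - f x0).
- by apply: (@euclid_norm_compact _ _ [set 1] 1) => [|r ->//]; exact: closed_eq.
- move=> u /= u1.
  have tauu : (tau%:E < lower_dq q f x0 u)%E.
    have : (lower_dq_norm q f x0 <= maxe 0 (lower_dq q f x0 u))%E.
      by apply: ereal_inf_lbound; exists u.
    move=> /(lt_le_trans tauN); rewrite lt_max lte_fin => /orP[|//].
    by rewrite ltNge ltW.
  move: tauu; rewrite /lower_dq limf_einfE => /ereal_sup_gt[_ [V FV <-] tauV].
  case: FV => -[A B] /= [uA B0] ABV.
  exists (A, B `&` [set t | 0 < t]) => /=.
    by split=> //; apply: filterI => //; exact: nbhs_right_gt.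
  move=> [u' t]/= [Au' [Bt t0]]; rewrite -ltr_pdivlMr ?powR_gt0//.
  rewrite -lte_fin; apply: (lt_le_trans tauV); apply: ereal_inf_lbound.
  by exists (u', t) => //; exact: ABV.
exists tau => //; exists (ball x0 e); first exact: nbhsx_ballx.
move=> y; rewrite -ball_normE/= distrC => ye.
have [->|yx] := eqVneq y x0.
  by rewrite !subrr normr0 powR0 ?mulr0// gt_eqF.
have y0 : 0 < `|y - x0| by rewrite normr_gt0 subr_eq0.
have := eP `|y - x0| (`|y - x0|^-1 *: (y - x0)); rewrite y0 ye/= => /(_ isT).
rewrite normrZ normfV normr_id mulVf ?gt_eqF// => /(_ erefl).
by rewrite scalerA divff ?gt_eqF// scale1r [x0 + _]addrC subrK => /ltW.
Qed.

End LowerDerivative.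

Section GraphicalDerivativeModulus.
Context (R : realType) (X Y : normedModType R) (q : R) (q0 : 0 < q).
Context (S : Y -> set X) (y0 : Y) (x0 : X).
Local Notation D := (graph_deriv q^-1 S y0 x0).

(** At the approximating points (t^(1/q))^q = t cancels in the calmness inequality, leaving tau
    |w'|^q <= |u'|. *)
Lemma graph_deriv_modulus (tau : R) u w :
  isolated_calm_with q tau S y0 x0 -> D u w -> tau * `|w| `^ q <= `|u|.
Proof.
move=> [tau0 [U [V [/nbhs_ballP[d /= d0 dU] /nbhs_ballP[e /= e0 eV] tauUV]]]].
move=> /graph_derivP Duw.
(* The limit is taken with s < |w|, which avoids the continuity of powR at 0. *)
have below s : 0 <= s -> s < `|w| -> tau * s `^ q <= `|u|.
  move=> s0 sw; apply/ler_addgt0Pr => r r0.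
  (* The bound t < k means t^(1/q) (|w| + 1) < d, which puts the point into [U]. *)
  pose k := (d / (`|w| + 1)) `^ q.
  have w1 : 0 < `|w| + 1 by rewrite ltr_wpDl.
  have ur : 0 < `|u| + r by rewrite ltr_wpDl.
  pose m := Num.min (Num.min 1 r) (Num.min (`|w| - s) (Num.min k (e / (`|u| + r)))).
  have [|u' [w' [t [u'u w'w /andP[t0 tm] St]]]] := Duw m.
    by rewrite !lt_min ltr01 r0 subr_gt0 sw powR_gt0 divr_gt0.
  move: u'u w'w tm; rewrite !lt_min => /andP[/andP[_ u'u] _].
  move=> /andP[/andP[w'w1 _] /andP[w'ws _]] /andP[_ /and3P[_ tk te]].
  have u'r : `|u'| <= `|u| + r.
    by have := lerB_dist u' u; lra.
  have w's : s <= `|w'|.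
    by have := lerB_dist w w'; rewrite distrC; lra.
  have w'1 : `|w'| <= `|w| + 1.
    by have := lerB_dist w' w; lra.
  have tq : (t `^ q^-1) `^ q = t.
    by rewrite -powRrM mulVf ?gt_eqF// powRr1// ltW.
  have := tauUV (y0 + t *: u') (x0 + t `^ q^-1 *: w').
  rewrite ![_ + _ *: _ - _]addrAC !subrr !add0r !normrZ ger0_norm ?powR_ge0//.
  rewrite gtr0_norm// powRM ?powR_ge0// tq mulrCA ler_pM2l// => tauS.
  have ts : tau * s `^ q <= tau * `|w'| `^ q.
    by rewrite ler_pM2l// ge0_ler_powR ?nnegrE// ltW.
  apply: (le_trans ts); apply: (le_trans _ u'r); apply: tauS => //.
    apply: eV; rewrite -ball_normE/= opprD addrA subrr add0r normrN normrZ gtr0_norm//.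
    apply: (@le_lt_trans _ _ (t * (`|u| + r))); first by rewrite ler_pM2l.
    by rewrite -ltr_pdivlMr.
  apply: dU; rewrite -ball_normE/= opprD addrA subrr add0r normrN normrZ.
  rewrite ger0_norm ?powR_ge0//.
  apply: (@le_lt_trans _ _ (t `^ q^-1 * (`|w| + 1))).
    by rewrite ler_wpM2l ?powR_ge0.
  rewrite -ltr_pdivlMr// ltNge; apply/negP => dt.
  move: tk; rewrite ltNge => /negP; apply.
  by rewrite /k ler_powR_root ?(ltW t0)// divr_ge0// ltW.
rewrite -ler_pdivlMl// mulrC.
have ut0 : 0 <= `|u| / tau by rewrite divr_ge0// ltW.
rewrite ler_powR_root// leNgt; apply/negP => lt.
pose s := ((`|u| / tau) `^ q^-1 + `|w|) / 2.
have s0 : 0 <= s by rewrite divr_ge0// addr_ge0// powR_ge0.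
have := below s s0; rewrite -ler_pdivlMl// mulrC ler_powR_root// /s; lra.
Qed.

Lemma outer_norm_ge0 : (0 <= outer_norm q^-1 D)%E.
Proof. by apply: ereal_sup_ubound; left. Qed.

Lemma outer_norm_le_modulus (tau : R) : isolated_calm_with q tau S y0 x0 ->
  (outer_norm q^-1 D <= (tau^-1 `^ q^-1)%:E)%E.
Proof.
move=> taucalm; have [tau0 _] := taucalm.
have ti0 : 0 <= tau^-1 by rewrite invr_ge0 ltW.
apply: ub_ereal_sup => _ [->|[[u w] /= [/(graph_deriv_modulus taucalm) uw uw0] <-]].
  by rewrite lee_fin powR_ge0.
(* With u = 0 the modulus inequality would force w = 0, and the pair (0, 0) is excluded. *)
have u0 : u != 0.
  apply: contra_notN uw0 => /eqP u0; move: uw; rewrite u0 normr0.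
  rewrite pmulr_rle0// => w0.
  have : `|w| `^ q == 0 by rewrite eq_le w0 powR_ge0.
  by rewrite powR_eq0 normr_eq0 => /andP[/eqP ->].
have un : 0 < `|u| `^ q^-1 by rewrite powR_gt0 ?normr_gt0.
rewrite inver gt_eqF// -EFinM lee_fin ler_pdivrMr// -powRM//.
by rewrite -ler_powR_root// ?mulr_ge0// ler_pdivlMl.
Qed.

Lemma outer_norm_lty_of_calm : isolated_calm q S y0 x0 ->
  (outer_norm q^-1 D < +oo)%E.
Proof. by move=> [tau /outer_norm_le_modulus/le_lt_trans]; apply; rewrite ltry. Qed.

Lemma clm_le : (clm q S y0 x0 <= epowN (outer_norm q^-1 D) q)%E.
Proof.
apply: ub_ereal_sup => _ [->|[tau taucalm <-]].
  by rewrite /epowN inve_ge0 poweR_ge0.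
have [tau0 _] := taucalm.
by rewrite le_epowN ?outer_norm_ge0// outer_norm_le_modulus.
Qed.

(** A violating pair, rescaled with t = |x - x0|^q, has |w| = 1 and |u| <= tau. The derivative
    contains no such pair, so compactness excludes all small [t]. *)
Lemma modulus_of_outer_norm (tau : R) :
  compact [set u : Y | `|u| <= tau] -> compact [set w : X | `|w| = 1] ->
  0 < tau -> (tau%:E < epowN (outer_norm q^-1 D) q)%E ->
  isolated_calm_with q tau S y0 x0.
Proof.
move=> cY cX tau0; rewrite ltNge ge_epowN ?outer_norm_ge0// => /negP Ntau.
have [||e e0 eP] := @graph_derivN_compact R Y X q^-1 S y0 x0
    ([set u | `|u| <= tau] `*` [set w | `|w| = 1]).
- exact: compact_setX.
- move=> [u w] [/= utau w1] Duw; apply: Ntau.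
  have : (`|w|%:E / (`|u| `^ q^-1)%:E <= outer_norm q^-1 D)%E.
    apply: ereal_sup_ubound; right; exists (u, w) => //; split=> // -[_ w0].
    by move: w1; rewrite w0 normr0 => /eqP; rewrite eq_sym oner_eq0.
  apply: le_trans; rewrite w1 mul1e inver; case: ifPn => [_|u0]; first by rewrite leey.
  rewrite lee_fin -powR_inv1 ?(ltW tau0)// powRAC powR_inv1 ?powR_ge0//.
  have un : 0 < `|u| `^ q^-1 by rewrite lt_def u0 powR_ge0.
  rewrite lef_pV2 ?posrE// ?powR_gt0//.
  by rewrite ge0_ler_powR ?nnegrE ?invr_ge0// ltW.
split=> //; exists (ball x0 (e `^ q^-1)), setT; split; first 2 last.
- move=> y x _ Sy; rewrite -ball_normE/= distrC => xe.
  rewrite leNgt; apply/negP => yx.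
  have x0' : 0 < `|x - x0|.
    rewrite lt_def normr_ge0 andbT; apply/eqP => xx0.
    by move: yx; rewrite xx0 powR0 ?gt_eqF// mulr0 ltNge normr_ge0.
  pose t := `|x - x0| `^ q.
  have t0 : 0 < t by rewrite powR_gt0.
  have te : t < e.
    rewrite ltNge; apply/negP; rewrite -ler_root_powR//; last exact: ltW.
    by rewrite leNgt xe.
  have tq : t `^ q^-1 = `|x - x0| by rewrite -powRrM divff ?gt_eqF// powRr1.
  apply: (eP t (t^-1 *: (y - y0), `|x - x0|^-1 *: (x - x0))).
  + by rewrite t0.
  + split=> /=; rewrite normrZ normfV ?normr_id ?mulVf ?gt_eqF//.
    by rewrite gtr0_norm// ler_pdivrMl// mulrC ltW.
  + by rewrite /= tq !scalerA !divff ?gt_eqF// !scale1r ![_ + (_ - _)]addrC !subrK.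
- by apply: nbhsx_ballx; exact: powR_gt0.
- exact: filterT.
Qed.

Lemma calm_and_clm_of_compact :
  (forall tau : R, compact [set u : Y | `|u| <= tau]) ->
  compact [set w : X | `|w| = 1] ->
  ((outer_norm q^-1 D < +oo)%E -> isolated_calm q S y0 x0) /\
  clm q S y0 x0 = epowN (outer_norm q^-1 D) q.
Proof.
move=> cY cX.
have calm t := modulus_of_outer_norm (cY t) cX.
split; last first.
  apply/eqP; rewrite eq_le clm_le/=; apply: ereal_le_real => [|t t0 tN].
    by apply: ereal_sup_ubound; left.
  by apply: ereal_sup_ubound; right; exists t => //; exact: calm.
have := outer_norm_ge0; have := @le_epowN _ (outer_norm q^-1 D) _ q q0.
case: (outer_norm q^-1 D) calm => [r| |]// calm le_epow r0 _.
rewrite lee_fin in r0.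
(* Taking r + 1 covers r = 0; halving [t] yields the strict inequality. *)
pose t := ((r + 1) `^ q)^-1.
have t0 : 0 < t by rewrite invr_gt0 powR_gt0// ltr_wpDl.
have tN : (t%:E <= epowN r%:E q)%E.
  rewrite le_epow ?lee_fin// invrK -powRrM divff ?gt_eqF// powRr1 ?lerDl//.
  by rewrite addr_ge0.
exists (t / 2); apply: calm; first exact: divr_gt0.
by apply: lt_le_trans tN; rewrite lte_fin gtr_pMr// invf_lt1// ltr1n.
Qed.

End GraphicalDerivativeModulus.

(** * Compact balls of C(T, R) for finite T *)

Section FiniteIndexSet.
Context (R : realType) (T : topologicalType) (cT : compact [set: T]).

Lemma ctsfun_ball_compact (M : R) : hausdorff_space T -> finite_set [set: T] ->
  compact [set u : @ctsfun R T cT | `|u| <= M].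
Proof.
move=> hT fT.
have closedT (A : set T) : closed A.
  have /hausdorff_accessible/accessible_finite_set_closed := hT; apply.
  exact: sub_finite_set fT.
(* A finite Hausdorff space is discrete, so C(T, R) is all of R^T. *)
have openT (A : set T) : open A by rewrite -[A]setCK openC.
have discrete (g : T -> R) : continuous g.
  by apply/continuousP => A _; exact: openT.
pose F (g : prod_topology (fun _ : T => R)) : @ctsfun R T cT :=
  (mkcts (discrete g) : continuousType T R).
(* On a compact discrete space closeness at every point is uniform, so the product topology controls
   the norm. *)
have Fc : continuous F.
  move=> g; apply/(@cvgrPdist_le _ _ _ (nbhs g)) => e e0.
  have : \forall h \near g, setT `<=` (fun t => `|g t - h t| <= e).
    apply: (iffLR (@compact_near_coveringP T setT) cT _ (nbhs g)
      (fun h t => `|g t - h t| <= e)) => t _.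
    exists ([set t], [set h | `|g t - h t| <= e]) => /=.
      split; first by apply: open_nbhs_nbhs; split.
      have pg : (h t : R) @[h --> g] --> (g t : R).
        exact: (@proj_continuous T (fun=> R) t g).
      by move/(@cvgrPdist_le R R^o _ (nbhs g)) : pg => /(_ e e0).
    by move=> [s h]/= [->].
  apply: (@filterS _ (nbhs g) (nbhs_filter g)) => h gh.
  have gh' t : `|F g t - F h t| <= e.
    exact: (gh t I).
  exact: (@ler_ctsfun_dist R T cT (F g) (F h) e (ltW e0) gh').
pose B : set (prod_topology (fun _ : T => R)) :=
  [set g | forall t, `[- M, M]%classic (g t)].
apply: (@subclosed_compact _ _ (F @` B)).
- rewrite (_ : mkset _ = (fun u => `|u|) @^-1` [set r : R | r <= M])//.
  apply: preimage_closed; last exact: closed_le.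
  by move=> u _; exact: norm_continuous.
- apply: continuous_compact; first exact: continuous_subspaceT.
  by apply: (@tychonoff _ _ (fun=> `[- M, M]%classic)) => t; exact: segment_compact.
- move=> u /= uM; exists (u : T -> R); last exact: ctsfunP.
  move=> t /=; rewrite in_itv/= -ler_norml (le_trans _ uM)//.
  by rewrite -[leRHS]/(supnorm u) supnorm_ub.
Qed.

End FiniteIndexSet.

(** * Positive definiteness of the subdifferential *)

Section Subdifferential.
Context (R : realType) (n : nat).
Local Notation E := (euclid R n).
Implicit Types (f : E -> R) (x y z u v : E).

(** The subgradient inequality at x0 + t u', tested at [x0], bounds tau t^q |u'|^q by t^q <w', u'>.
    The factor 2^(-q) comes from |u'| >= |u| / 2 and avoids a limit of powers. *)
Lemma pos_definite_of_sharp f x0 (q : R) : 0 < q -> sharp_minimizer q f x0 ->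
  pos_definite (q - 1) (graph_deriv (q - 1) (subdifferential f) x0 0).
Proof.
move=> q0 [tau tau0 [U /nbhs_ballP[d /= d0 dU] tauU]].
exists (tau * (2^-1) `^ q); first by rewrite mulr_gt0 ?powR_gt0.
move=> u w /graph_derivP Duw; rewrite subrK.
have [->|u0] := eqVneq u 0.
  by rewrite dot0r normr0 powR0 ?mulr0// gt_eqF.
have un : 0 < `|u| by rewrite normr_gt0.
rewrite -mulrA -powRM//; apply/ler_addgt0Pr => r r0.
have k0 : 0 < `|u| + 1 + `|w| by rewrite ltr_wpDr// ltr_wpDl.
have u1 : 0 < `|u| + 1 by rewrite ltr_wpDl.
pose e := Num.min (Num.min 1 (`|u| / 2))
  (Num.min (r / (`|u| + 1 + `|w|)) (d / (`|u| + 1))).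
have [|u' [w' [t [+ + /andP[t0]]]]] := Duw e.
  by rewrite !lt_min ltr01 !divr_gt0.
rewrite !lt_min => /andP[/andP[u'1 u'2] /andP[u'r _]].
move=> /andP[/andP[w'1 _] /andP[w'r _]] /andP[_ /andP[_ td]].
have u'u1 : `|u'| <= `|u| + 1 by have := lerB_dist u' u; lra.
have u'u2 : 2^-1 * `|u| <= `|u'|.
  by have := lerB_dist u u'; rewrite distrC; lra.
move=> /(_ x0); rewrite add0r opprD addrA subrr add0r dotNr dotZr dotZl => sub.
have /tauU : U (x0 + t *: u').
  apply: dU; rewrite -ball_normE/= opprD addrA subrr add0r normrN normrZ gtr0_norm//.
  apply: (@le_lt_trans _ _ (t * (`|u| + 1))); first by rewrite ler_pM2l.
  by rewrite -ltr_pdivlMr.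
rewrite addrAC subrr add0r normrZ gtr0_norm// (powRM _ (ltW t0))// => ft.
have {}ft : tau * `|u'| `^ q <= dot w' u'.
  rewrite -(ler_pM2l (powR_gt0 q t0)) mulrCA (le_trans ft)//.
  by move: sub; rewrite mulrA mulr_powRB1 ?(ltW t0)//; lra.
apply: (@le_trans _ _ (tau * `|u'| `^ q)).
  by rewrite ler_pM2l// ge0_ler_powR ?nnegrE ?mulr_ge0 ?invr_ge0// ltW.
apply: (le_trans ft); rewrite -lerBlDl.
have -> : dot w' u' - dot w u = dot (w' - w) u' + dot w (u' - u).
  by rewrite dotBl dotBr addrA subrK.
apply: (@le_trans _ _ (r / (`|u| + 1 + `|w|) * (`|u| + 1 + `|w|))); last first.
  by rewrite mulfVK// gt_eqF.
rewrite [leRHS]mulrDr lerD// (le_trans (ler_dot _ _))//.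
  by rewrite ler_pM// ltW.
by rewrite mulrC ler_pM// ltW.
Qed.

Section Convex.
Context (f : E -> R) (cf : continuous f).
Context (convf : forall y z (s : R), 0 <= s <= 1 ->
  f (y + s *: (z - y)) <= f y + s * (f z - f y)).

(** First-order optimality of [z] on the segment to [u], where convexity bounds [f] and only the
    linear part of the penalty survives. *)
Lemma prox_subgradient (k : R) y z : 0 <= k ->
  (forall u, f z + k * `|z - y| ^+ 2 <= f u + k * `|u - y| ^+ 2) ->
  subdifferential f z (- (2 * k) *: (z - y)).
Proof.
move=> k0 zmin u; rewrite dotZl mulNr lerNl -subr_ge0 opprK.
apply: (@linear_ge0_of_quadratic _ _ (k * dot (u - z) (u - z))) => [|s s01].
  by rewrite mulr_ge0// dot_ge0.
have s01' : 0 <= s <= 1 by case/andP: s01 => /ltW ->.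
have := zmin (z + s *: (u - z)); have := convf z u s01'.
have -> : z + s *: (u - z) - y = (z - y) + s *: (u - z) by rewrite addrAC.
move: (z - y) (u - z) => p r.
rewrite -!dotxx !(dotDl, dotDr, dotZl, dotZr) (dotC r p); lra.
Qed.

Lemma exists_small_subgradient (m d t : R) y : 0 < d -> 0 < t ->
  (forall u, m <= f u) -> f y <= m + d ->
  exists z v, [/\ subdifferential f z v, `|z - y| <= t / 2 & `|v| <= 4 * d / t].
Proof.
move=> d0 t0 mf fy.
(* The weight k is chosen so that k (t / 2)^2 = d, which keeps the minimizer of
   f + k |. - y|^2 in the ball of radius t / 2. *)
pose k := 4 * d / t ^+ 2.
have k0 : 0 < k by rewrite divr_gt0 ?mulr_gt0 ?exprn_gt0.
pose g u := f u + k * `|u - y| ^+ 2.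
pose B := [set u : E | `|u - y| <= t / 2].
have dyc : continuous (fun u : E => `|u - y|).
  move=> u; apply: (@cvg_norm _ E _ (nbhs u)).
  by apply: (@cvgB _ E _ (nbhs u) _ id (fun=> y)); [exact: cvg_id|exact: cvg_cst].
have cB : compact B.
  apply: (@euclid_compact _ _ _ (t / 2 + `|y|)) => [|u /= uy].
    rewrite (_ : B = (fun u => `|u - y|) @^-1` [set r : R | r <= t / 2])//.
    by apply: preimage_closed; [move=> u _; exact: dyc|exact: closed_le].
  by have := lerB_dist u y; move: uy; rewrite /B/=; lra.
have gc : continuous g.
  move=> u; apply: (@cvgD _ R^o _ (nbhs u) _ f (fun u => k * `|u - y| ^+ 2)).
    exact: cf.
  apply: (@cvgM _ _ (nbhs u) _ (fun=> k) (fun u => `|u - y| ^+ 2)).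
    exact: cvg_cst.
  by apply: (@cvgM _ _ (nbhs u) _ (fun u => `|u - y|) (fun u => `|u - y|)); exact: dyc.
have yB : B y by rewrite /B/= subrr normr0 divr_ge0 ?ltW.
have Bn : B !=set0 by exists y.
have [z zB zmin] := compact_EVT_min Bn cB (continuous_subspaceT gc).
rewrite inE/= in zB.
exists z, (- (2 * k) *: (z - y)); split=> //.
  apply: prox_subgradient => [|u]; first exact: ltW.
  have [uB|uB] := leP `|u - y| (t / 2); first by apply: zmin; rewrite inE.
  (* Outside the ball the penalty alone is at least [d], so [u] cannot beat [y]. *)
  apply: (@le_trans _ _ (g y)); first by apply: zmin; rewrite inE.
  rewrite /g subrr normr0 expr0n/= mulr0 addr0 (le_trans fy)// lerD//.
  have -> : d = k * (t / 2) ^+ 2.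
    by rewrite /k; field; rewrite gt_eqF.
  by rewrite ler_pM2l// ler_pXn2r// ?nnegrE ?(ltW uB)// divr_ge0// ltW.
have k2 : 0 < 2 * k by rewrite mulr_gt0.
rewrite normrZ normrN gtr0_norm//.
apply: (@le_trans _ _ (2 * k * (t / 2))); first by rewrite ler_pM2l.
by rewrite le_eqVlt; apply/orP; left; apply/eqP; rewrite /k; field; rewrite gt_eqF.
Qed.

Lemma sharp_of_pos_definite x0 (q : R) : 0 < q -> (forall u, f x0 <= f u) ->
  pos_definite (q - 1) (graph_deriv (q - 1) (subdifferential f) x0 0) ->
  sharp_minimizer q f x0.
Proof.
move=> q0 fmin [l l0]; rewrite subrK => pd.
(* For 1/2 <= |u| <= 3/2 positive definiteness gives <w, u> >= l 2^(-q) = 2 mu, while |w| <= mu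
   allows at most 3 mu / 2. *)
pose mu := l * 2^-1 `^ q / 2.
have mu0 : 0 < mu by rewrite divr_gt0 ?mulr_gt0 ?powR_gt0.
have [||e e0 eP] := @graph_derivN_compact R E E (q - 1) (subdifferential f) x0 0
    ([set u | 1 / 2 <= `|u| <= 3 / 2] `*` [set w | `|w| <= mu]).
- apply: compact_setX.
    apply: (@euclid_norm_compact _ _ [set r | 1 / 2 <= r <= 3 / 2] (3 / 2));
      last by move=> r /andP[].
    rewrite (_ : mkset _ = `[1 / 2, 3 / 2]%classic); first exact: interval_closed.
    by apply/seteqP; split=> r; rewrite /= in_itv.
  by apply: (@euclid_norm_compact _ _ [set r | r <= mu] mu) => //; exact: closed_le.
- move=> [u w] [/= /andP[u1 u2] wmu] /pd.
  have : l * 2^-1 `^ q <= l * `|u| `^ q.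
    by rewrite ler_pM2l// ge0_ler_powR ?nnegrE ?invr_ge0// ?(ltW q0)//; lra.
  have : dot w u <= mu * (3 / 2) by rewrite (le_trans (ler_dot _ _))// ler_pM.
  by rewrite /mu; move: mu0; rewrite /mu; lra.
exists (mu / 4); first exact: divr_gt0.
exists (ball x0 e); first exact: nbhsx_ballx.
move=> y; rewrite -ball_normE/= distrC => ye.
have [->|yx] := eqVneq y x0.
  by rewrite !subrr normr0 powR0 ?mulr0// gt_eqF.
set t := `|y - x0|.
have t0 : 0 < t by rewrite normr_gt0 subr_eq0.
rewrite leNgt; apply/negP => fy.
have tq0 : 0 < t `^ (q - 1) by rewrite powR_gt0.
have tq : t * t `^ (q - 1) = t `^ q by rewrite mulr_powRB1 // ltW.
(* With d = (mu / 4) t^q the bound 4 d / t is mu t^(q-1), and |z - y| <= t / 2 keeps |z - x0|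
   between t / 2 and 3 t / 2: rescaling lands in the excluded set. *)
have [||z [v [fzv zy vt]]] :=
  @exists_small_subgradient (f x0) (mu / 4 * t `^ q) t y _ t0 fmin.
- by apply: mulr_gt0; [exact: divr_gt0|exact: powR_gt0].
- by rewrite -lerBlDl ltW.
apply: (eP t (t^-1 *: (z - x0), (t `^ (q - 1))^-1 *: v)).
- by rewrite t0.
- split=> /=.
    rewrite normrZ gtr0_norm ?invr_gt0// ler_pdivlMl// ler_pdivrMl//.
    have zx : z - x0 = (z - y) + (y - x0) by rewrite addrA subrK.
    have := ler_normD (z - y) (y - x0); rewrite -zx -/t.
    have := lerB_dist (y - x0) (y - z).
    rewrite opprB [y - x0 + (z - y)]addrC -zx (distrC y z) -/t.
    lra.
  rewrite normrZ gtr0_norm ?invr_gt0// ler_pdivrMl// (le_trans vt)//.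
  rewrite -tq le_eqVlt; apply/orP; left; apply/eqP; field.
  by rewrite gt_eqF.
- rewrite /= !scalerA !divff ?gt_eqF// !scale1r add0r [x0 + _]addrC subrK.
  exact: fzv.
Qed.

End Convex.
End Subdifferential.

(** * Assembly of the equivalences *)

Theorem theorem4p2 (R : realType) (n : nat) (T : topologicalType)
    (cT : compact [set: T]) (hT : hausdorff_space T) (T0 : [set: T] !=set0)
    (a : T -> euclid R n) (ca : continuous a)
    (q : R) (q0 : 0 < q)
    (c : euclid R n) (b : ctsfun R cT) (x : euclid R n)
    (hx : solutions a (c, b) x) (hb : slater a b) :
  let i := isolated_calm q (solutions a) (c, b) x in
  let ii := isolated_calm q (solutions_at a c) b x in
  let iii := isolated_calm q (level_set a c) (dot c x, b) x in
  let iv := sharp_minimizer q (max_fun a c b x) x in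
  let v := (0 < lower_dq_norm q (max_fun a c b x) x)%E in
  let vi := (outer_norm q^-1
               (graph_deriv q^-1 (solutions_at a c) b x) < +oo)%E in
  let vii := pos_definite (q - 1)
               (graph_deriv (q - 1) (subdifferential (max_fun a c b x)) x 0) in
  [/\ [/\ i <-> ii, ii <-> iii, iii <-> iv, iv <-> v & v -> vi],
      finite_set [set: T] ->
        [/\ i <-> ii, ii <-> iii, iii <-> iv, iv <-> v & v <-> vi] /\
        clm q (solutions_at a c) b x =
          epowN (outer_norm q^-1
            (graph_deriv q^-1 (solutions_at a c) b x)) q &
      1 < q ->
        [/\ i <-> ii, ii <-> iii, iii <-> iv, iv <-> v & v <-> vii]].
Proof.
move=> i ii iii iv v vi vii.
have iv_i : iv -> i by exact: solutions_calm_of_sharp.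
have i_ii : i -> ii by exact: solutions_at_calm_of_solutions_calm.
have ii_iv : ii -> iv by exact: sharp_of_solutions_at_calm.
have iv_iii : iv -> iii by exact: level_set_calm_of_sharp.
have iii_iv : iii -> iv by exact: sharp_of_level_set_calm.
have iv_v : iv <-> v.
  by split; [exact: lower_dq_norm_gt0|exact: sharp_of_lower_dq_norm].
have ii_vi : ii -> vi by exact: outer_norm_lty_of_calm.
have equiv : [/\ i <-> ii, ii <-> iii, iii <-> iv & iv <-> v] by split; tauto.
have [e1 e2 e3 e4] := equiv.
split=> [|fT|q1]; first by split=> //; tauto.
  have [|vi_ii clmE] := @calm_and_clm_of_compact _ _ _ q q0 (solutions_at a c) b x
      (fun tau => @ctsfun_ball_compact _ _ cT tau hT fT).
    by apply: (@euclid_norm_compact _ _ [set 1] 1) => [|r ->//]; exact: closed_eq.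
  by split=> //; split=> //; tauto.
split=> //; rewrite -e4; split; first exact: pos_definite_of_sharp.
apply: sharp_of_pos_definite => //.
- exact: max_fun_continuous.
- by move=> y z s; exact: max_fun_convex.
- by move=> y; rewrite (max_fun0 T0 ca hx) max_fun_ge0.
Qed.
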